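(* Let $T\ge 1$ be an integer, let $U\subset\mathbb R^m$ be a nonempty Borel set, let $f_t:\mathbb R^n\times\mathbb R^m\to\mathbb R^n$ ($t=0,\dots,T-1$) be functions, let $\mu\in\mathcal P_2(\mathbb R^n)$, let $x_0$ be a random variable with distribution $\mu$, and let $\mathfrak t\in L^2(\mu)^n$. Suppose that: (i) the control set $U$ is convex; (ii) for each $t\in\{0,\dots,T-1\}$, the function $f_t$ is differentiable with uniformly continuous partial derivatives and there exists $m_t>0$ such that $$|f_t(x,u)|\le m_t\big(1+|x|+|u|\big)\quad\text{for all }(x,u)\in\mathbb R^n\times\mathbb R^m.$$ Let $\hat\varphi=\{\hat\varphi_t\}_{t=0}^{T-1}\in\Phi$ be a Markov policy such that each $\hat\varphi_t:\mathbb R^n\to\mathbb R^m$ is differentiable with uniformly continuous partial derivatives. For $t\in\{1,\dots,T\}$ define the random variable $$p_t:=\prod_{s=t}^{T-1}\Big(\frac{\partial f_s}{\partial x}\big(x_s^{\hat\varphi},\hat\varphi_s(x_s^{\hat\varphi})\big)+\frac{\partial f_s}{\partial u}\big(x_s^{\hat\varphi},\hat\varphi_s(x_s^{\hat\varphi})\big)\frac{\partial\hat\varphi_s}{\partial x}(x_s^{\hat\varphi})\Big)^\top\,\mathbb E\big[x_T^{\hat\varphi}-\mathfrak t(x_0)\,\big|\,x_{t-1}^{\hat\varphi}\big].$$ If $\hat\varphi$ is optimal for the problem of minimizing $\mathcal J$ over $\Phi$, then (almost surely): (a) $p_T=x_T^{\hat\varphi}-\mathbb E\big[\mathfrak t(x_0)\,\big|\,x_{T-1}^{\hat\varphi}\big]$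 and, for all $t\in\{1,\dots,T-1\}$, $$\mathbb E\big[p_t\,\big|\,x_t^{\hat\varphi}\big]=\frac{\partial f_t}{\partial x}\big(x_t^{\hat\varphi},\hat\varphi_t(x_t^{\hat\varphi})\big)^\top p_{t+1};$$ (b) for all $t\in\{0,\dots,T-1\}$, $$0\in\frac{\partial f_t}{\partial u}\big(x_t^{\hat\varphi},\hat\varphi_t(x_t^{\hat\varphi})\big)^\top p_{t+1}+N_U\big(\hat\varphi_t(x_t^{\hat\varphi})\big).$$
   Context: $\mathbb R^d$ carries its Euclidean norm $|\cdot|$ and inner product $\langle\cdot,\cdot\rangle$; its elements are column vectors. $\mathcal P_2(\mathbb R^n)$ is the set of Borel probability measures on $\mathbb R^n$ with finite second moment. $L^2(\mu)^n$ is the set of Borel maps $\mathfrak t:\mathbb R^n\to\mathbb R^n$ with $\int_{\mathbb R^n}|\mathfrak t(x)|^2\,\mu(dx)<\infty$. A Markov policy is a sequence $\varphi=\{\varphi_t\}_{t=0}^{T-1}$ of Borel functions $\varphi_t:\mathbb R^n\to\mathbb R^m$ with $\varphi_t(x)\in U$ for all $x\in\mathbb R^n$; $\Phi$ is the set of all Markov policies. For $\varphi\in\Phi$, the associated states $\{x_t^\varphi\}_{t=0}^T$ are defined by $x_0^\varphi=x_0$ and $x_{t+1}^\varphi=f_t\big(x_t^\varphi,\varphi_t(x_t^\varphi)\big)$ for $t=0,\dots,T-1$. The objective functional $\mathcal J:\Phi\to\mathbb R\cup\{+\infty\}$ is $$\mathcal J(\varphi):=\tfrac12\,\mathbb E\big|x_T^\varphi-\mathfrak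 t(x_0)\big|^2 .$$ A policy $\hat\varphi\in\Phi$ is optimal if $\mathcal J(\hat\varphi)<+\infty$ and $\mathcal J(\hat\varphi)\le\mathcal J(\varphi)$ for all $\varphi\in\Phi$. $\frac{\partial f}{\partial x}(x,u)$ is the $n\times n$ matrix with entries $\frac{\partial f_i}{\partial x_j}(x,u)$ and $\frac{\partial f}{\partial u}(x,u)$ is the $n\times m$ matrix with entries $\frac{\partial f_i}{\partial u_j}(x,u)$; similarly $\frac{\partial\hat\varphi_s}{\partial x}$ is the $m\times n$ Jacobian of $\hat\varphi_s$. $M^\top$ is the transpose of $M$. Matrix products are ordered as $\prod_{s=\tau}^{t}M_s=M_\tau M_{\tau+1}\cdots M_t$ if $t\ge\tau$, and equal the identity $I$ if $t<\tau$ (in the definition of $p_t$ the factors $M_s$ are the transposed matrices). For a convex set $U\subset\mathbb R^m$ and $\hat x\in U$, the normal cone is $N_U(\hat x):=\{y\in\mathbb R^m:\langle y,x-\hat x\rangle\le 0\ \ \forall x\in U\}$. The sum of sets is $A+B=\{a+b:a\in A,\,b\in B\}$, with a vector $a$ identified with $\{a\}$. Relations between random variables are understood almost surely. *)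

(* Defs.v *)
From HB Require Import structures.
From mathcomp Require Import all_boot all_order all_algebra.
From mathcomp Require Import all_classical all_reals all_analysis.
From mathcomp Require Import measurable_realfun.

Set Implicit Arguments.
Unset Strict Implicit.
Unset Printing Implicit Defensive.

Import Order.TTheory GRing.Theory Num.Theory.
Import numFieldNormedType.Exports.

Local Open Scope classical_set_scope.
Local Open Scope ring_scope.

(* The Borel sigma-algebra. The norm that the library puts on matrices is the
   max norm, but it induces the usual topology and uniformity. *)
HB.instance Definition _ (R : realType) (n : nat) :=
  Measurable.copy 'cV[R]_n (g_sigma_algebraType (@open 'cV[R]_n)).

Section euclidean.
Context {R : realType}.

Definition inner n (x y : 'cV[R]_n) : R := \sum_(i < n) x i 0 * y i 0.

Definition enorm n (x : 'cV[R]_n) : R := Num.sqrt (inner x x).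

(* The entry (i, j) is the partial derivative of g_i in the direction of the
   j-th basis vector; the library's [jacobian] acts on row vectors. *)
Definition jac k l (g : 'cV[R]_k -> 'cV[R]_l) (x : 'cV[R]_k) : 'M[R]_(l, k) :=
  \matrix_(i < l, j < k) 'D_(delta_mx j 0) (fun y => g y i 0 : R^o) x.

Definition jac_x n m (f : 'cV[R]_n * 'cV[R]_m -> 'cV[R]_n)
    (z : 'cV[R]_n * 'cV[R]_m) : 'M[R]_n :=
  jac (fun x => f (x, z.2)) z.1.

Definition jac_u n m (f : 'cV[R]_n * 'cV[R]_m -> 'cV[R]_n)
    (z : 'cV[R]_n * 'cV[R]_m) : 'M[R]_(n, m) :=
  jac (fun u => f (z.1, u)) z.2.

Definition normal_cone m (U : set 'cV[R]_m) (xhat : 'cV[R]_m) : set 'cV[R]_m :=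
  [set y | forall x, U x -> inner y (x - xhat) <= 0].

Definition finite_second_moment n (mu : probability 'cV[R]_n R) : Prop :=
  (\int[mu]_x (enorm x ^+ 2)%:E < +oo)%E.

Definition L2 n (mu : probability 'cV[R]_n R) : set ('cV[R]_n -> 'cV[R]_n) :=
  [set g | measurable_fun setT g /\
    (\int[mu]_x (enorm (g x) ^+ 2)%:E < +oo)%E].

End euclidean.

Section conditional_expectation.
Context {d d' : measure_display} {Omega : measurableType d}
  {T' : measurableType d'} {R : realType}.
Variables (P : probability Omega R) (Y : Omega -> T').

Definition is_cond_exp_ge0 (X Z : Omega -> \bar R) : Prop :=
  [/\ forall w, (0 <= Z w)%E,
      measurable_fun setT (Z : g_sigma_algebra_preimageType Y -> \bar R) &
      forall A, g_sigma_algebra_preimage Y A ->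
        (\int[P]_(w in A) Z w = \int[P]_(w in A) X w)%E].

(* Z is a (finite) version of E[X | Y] = E[X^+ | Y] - E[X^- | Y]. For integrable
   X this is the usual notion; in general it only asks that E[|X| | Y] be finite
   almost surely. As Z is real-valued and +oo - +oo = -oo in \bar R, the last
   equation forces both terms to be finite. *)
Definition is_cond_exp (X Z : Omega -> R) : Prop :=
  measurable_fun setT (Z : g_sigma_algebra_preimageType Y -> R) /\
  exists Zp Zn : Omega -> \bar R,
    [/\ is_cond_exp_ge0 ((EFin \o X)^\+)%E Zp,
        is_cond_exp_ge0 ((EFin \o X)^\-)%E Zn &
        {ae P, forall w, (Z w)%:E = (Zp w - Zn w)%E}].

(* A chosen version, and the zero function if there is none. *)
Definition cond_exp (X : Omega -> R) : Omega -> R :=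
  xget (cst 0) [set Z | is_cond_exp X Z].

Definition vcond_exp n (X : Omega -> 'cV[R]_n) : Omega -> 'cV[R]_n :=
  fun w => \col_(i < n) cond_exp (fun w' => X w' i 0) w.

End conditional_expectation.

Section control_problem.
Context {R : realType} {n m : nat} {d : measure_display}
  {Omega : measurableType d}.
Variables (P : probability Omega R) (T : nat) (U : set 'cV[R]_m)
  (f : nat -> 'cV[R]_n * 'cV[R]_m -> 'cV[R]_n)
  (x0 : Omega -> 'cV[R]_n) (target : 'cV[R]_n -> 'cV[R]_n).

(* Dynamics and policies are indexed by nat, but only the indices t < T are
   constrained or used. *)
Definition markov_policy : set (nat -> 'cV[R]_n -> 'cV[R]_m) :=
  [set phi | forall t, (t < T)%N ->
    measurable_fun setT (phi t) /\ forall x, U (phi t x)].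

Fixpoint state (phi : nat -> 'cV[R]_n -> 'cV[R]_m) (t : nat) (w : Omega) :
    'cV[R]_n :=
  if t is s.+1 then f s (state phi s w, phi s (state phi s w)) else x0 w.

Definition objective (phi : nat -> 'cV[R]_n -> 'cV[R]_m) : \bar R :=
  ((2^-1)%:E * 'E_P[fun w => (enorm (state phi T w - target (x0 w)) ^+ 2)%R])%E.

Definition optimal (phi : nat -> 'cV[R]_n -> 'cV[R]_m) : Prop :=
  [/\ markov_policy phi,
      (objective phi < +oo)%E &
      forall psi, markov_policy psi -> (objective phi <= objective psi)%E].

Variable phi : nat -> 'cV[R]_n -> 'cV[R]_m.

Definition state_control (t : nat) (w : Omega) : 'cV[R]_n * 'cV[R]_m :=
  (state phi t w, phi t (state phi t w)).

Definition closed_loop_jac (t : nat) (w : Omega) : 'M[R]_n :=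
  jac_x (f t) (state_control t w) +
  jac_u (f t) (state_control t w) *m jac (phi t) (state phi t w).

(* For 1 <= t <= T; the product is ordered by increasing s. *)
Definition costate (t : nat) (w : Omega) : 'cV[R]_n :=
  (\prod_(t <= s < T) (closed_loop_jac s w)^T) *m
  vcond_exp P (state phi t.-1) (fun w' => state phi T w' - target (x0 w')) w.

End control_problem.

(* Main.v *)
(** Write [W = x_T - target (x_0)]. Modify the optimal policy at one time [t], on
    a Borel set [B] of states, by moving [phi_t] a fraction [1/(k+1)] towards a
    point [v] of [U]. This changes [x_T] by [1_B(x_t) D(x_t)] for a continuous
    function [D], so optimality gives [E[1_B(x_t) (<W, D> + |D|^2/2)] >= 0].
    Restricting to sets where [D] is bounded, [W] may be replaced by
    [q = E[W | x_t]], and since [B] is arbitrary [<q, D> + |D|^2/2 >= 0] almost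
    surely, simultaneously for all [k] and all [v] in a countable dense subset of
    [U]. The limit in [k] is taken pointwise, so no domination is needed, and it
    yields (b) by density and the chain rule.

    The control [phi_t] takes its values in [U], so a normal vector at [phi_t x]
    is orthogonal to the range of the Jacobian of [phi_t] at [x]. Hence the
    feedback term disappears from [E[p_t | x_t] = (closed-loop Jacobian)^T p_(t+1)],
    which leaves (a). The latter identity is a pull-out property with unbounded
    factors. *)

Require Import Defs.
From HB Require Import structures.
From mathcomp Require Import all_boot all_order all_algebra.
From mathcomp Require Import all_classical all_reals all_analysis.
From mathcomp Require Import measurable_realfun.
From mathcomp Require Import ring lra.
Import Order.TTheory GRing.Theory Num.Theory.
Import numFieldNormedType.Exports.

Set Implicit Arguments.
Unset Strict Implicit.
Unset Printing Implicit Defensive.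

Local Open Scope classical_set_scope.
Local Open Scope ring_scope.

(** * Conditional expectations *)

Section preimage_algebra.
Context {d d'} {Om : measurableType d} {T' : measurableType d'}.
Variable Y : Om -> T'.
Local Notation G := (g_sigma_algebra_preimageType Y).

Lemma measurable_preimage_comp d2 (T2 : measurableType d2) (g : T' -> T2) :
  measurable_fun setT g -> measurable_fun setT (g \o Y : G -> T2).
Proof.
move=> mg _ B mB; rewrite setTI; exists (g @^-1` B); last by rewrite setTI.
by rewrite -[X in measurable X]setTI; exact: mg.
Qed.

Lemma measurable_preimageE (A : set G) :
  measurable A -> exists2 B : set T', measurable B & A = Y @^-1` B.
Proof. by case=> B mB <-; exists B => //; rewrite setTI. Qed.

Hypothesis mY : measurable_fun setT Y.

Lemma measurable_preimageW (A : set G) : measurable A -> measurable (A : set Om).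
Proof. by move=> [B mB <-]; exact: mY. Qed.

Lemma measurable_fun_preimageW d2 (T2 : measurableType d2) (D : set Om)
    (f : Om -> T2) :
  @measurable_fun _ _ G _ D f -> measurable (D : set G) -> measurable_fun D f.
Proof. by move=> mf mD _ B mB; by have := mf mD B mB; exact: measurable_preimageW. Qed.

End preimage_algebra.

Section conditional_expectation_theory.
Context {d d'} {Om : measurableType d} {T' : measurableType d'} {R : realType}.
Variables (P : probability Om R) (Y : Om -> T').
Hypothesis mY : measurable_fun setT Y.
Local Notation G := (g_sigma_algebra_preimageType Y).
Local Open Scope ereal_scope.

Import HBNNSimple.

(** Approximate [g] from below by simple functions measurable for the sigma-algebra of [Y]. For
    these the identity is a finite combination of the hypothesis over level sets, and monotone
    convergence passes to the limit. Both sides may be infinite. *)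
Lemma ge0_pull_out (u v g : Om -> R) :
  measurable_fun setT u -> measurable_fun setT v ->
  (forall w, 0 <= u w)%R -> (forall w, 0 <= v w)%R ->
  (forall A : set G, measurable A ->
    \int[P]_(w in A) (u w)%:E = \int[P]_(w in A) (v w)%:E) ->
  measurable_fun setT (g : G -> R) -> (forall w, 0 <= g w)%R ->
  \int[P]_w (g w * u w)%:E = \int[P]_w (g w * v w)%:E.
Proof.
move=> mu mv u0 v0 uv mg g0.
have mEg : measurable_fun setT (EFin \o g : G -> \bar R) by exact/measurable_EFinP.
pose h := nnsfun_approx measurableT mEg.
have mh n : measurable_fun setT (h n : Om -> R).
  by apply: measurable_fun_preimageW => //.
have hE (k : Om -> R) : measurable_fun setT k -> (forall w, 0 <= k w)%R ->
    \int[P]_w (g w * k w)%:E = lim (\int[P]_w ((h n w)%:E * (k w)%:E) @[n --> \oo]).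
  move=> mk k0.
  have gk w : (g w * k w)%:E = lim ((h n w)%:E * (k w)%:E @[n --> \oo]).
    apply/esym/cvg_lim => //; rewrite EFinM.
    apply: cvgeZr => //.
    by apply: (@cvg_nnsfun_approx _ _ _ _ measurableT _ mEg) => // x _; rewrite lee_fin.
  under eq_integral do rewrite gk.
  apply: monotone_convergence => //.
  - move=> n; by apply: emeasurable_funM; exact/measurable_EFinP.
  - by move=> n w _; rewrite mule_ge0// ?lee_fin.
  - move=> w _ a b ab; rewrite lee_wpmul2r// lee_fin//.
    by have /lefP := nd_nnsfun_approx measurableT mEg ab; exact.
rewrite !hE//.
suff -> : (fun n => \int[P]_w ((h n w)%:E * (u w)%:E)) =
          (fun n => \int[P]_w ((h n w)%:E * (v w)%:E)) by [].
apply/funext => n.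
have sE (k : Om -> R) : measurable_fun setT k -> (forall w, 0 <= k w)%R ->
    \int[P]_w ((h n w)%:E * (k w)%:E) =
    \sum_(y \in range (h n)) (y%:E * \int[P]_(w in h n @^-1` [set y]) (k w)%:E).
  move=> mk k0.
  transitivity (\int[P]_w (\sum_(y \in range (h n))
      (y * \1_(h n @^-1` [set y]) w)%:E * (k w)%:E)).
    apply: eq_integral => w _.
    rewrite -ge0_mule_fsuml => [|y]; last exact: (@nnfun_muleindic_ge0 _ G).
    by rewrite fsumEFin // -(@fimfunE G _ (h n) w).
  have mS y : measurable (h n @^-1` [set y] : set Om).
    by rewrite -[X in measurable X]setTI; exact: mh.
  rewrite ge0_integral_fsum//=.
  - apply: eq_fsbigr => y /[1!inE] -[w0 _ <-].
    under eq_integral do rewrite EFinM -muleA.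
    rewrite ge0_integralZl//.
    + rewrite [in RHS]integral_mkcond; congr (_ * _); apply: eq_integral => w _.
      by rewrite muleC epatch_indic.
    + apply: emeasurable_funM; exact/measurable_EFinP.
    + by move=> w _; rewrite mule_ge0// lee_fin.
    + by rewrite lee_fin.
  - move=> y; apply: emeasurable_funM; apply/measurable_EFinP => //.
    exact: measurable_funM.
  - by move=> y w _; rewrite mule_ge0// ?lee_fin//; exact: (@nnfun_muleindic_ge0 _ G).
  - exact: (@fimfunP G).
rewrite !sE//; apply: eq_fsbigr => y _; rewrite uv//.
Qed.

(** On the set [N k], where [Z' < Z] and [Z' <= k], the integral of [Z'] is finite and can be
    cancelled. The hypothesis then forces the positive function [Z - Z'] to have zero integral
    there, so [N k] is null. The sets [N k] exhaust the exceptional set. *)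
Lemma ge0_preimage_ae_le (Z Z' : Om -> \bar R) :
  (forall w, 0 <= Z w) -> (forall w, 0 <= Z' w) ->
  measurable_fun setT (Z : G -> \bar R) ->
  measurable_fun setT (Z' : G -> \bar R) ->
  (forall A : set G, measurable A ->
    \int[P]_(w in A) Z w <= \int[P]_(w in A) Z' w) ->
  {ae P, forall w, Z w <= Z' w}.
Proof.
move=> Z0 Z'0 mZ mZ' ZZ'.
have mZW : measurable_fun (setT : set Om) Z := measurable_fun_preimageW mY mZ measurableT.
have mZ'W : measurable_fun (setT : set Om) Z' := measurable_fun_preimageW mY mZ' measurableT.
pose N (k : nat) : set Om := [set w | Z' w < Z w] `&` [set w | Z' w <= k%:R%:E].
have mN k : measurable (N k : set G).
  apply: measurableI; rewrite -[X in measurable X]setTI.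
    exact: measurable_lte.
  by apply: measurable_lee => //; exact: measurable_cst.
have PN k : P (N k) = 0.
  have mNW := measurable_preimageW mY (mN k).
  have intE : \int[P]_(w in N k) Z w =
      \int[P]_(w in N k) Z' w + \int[P]_(w in N k) (Z w - Z' w).
    rewrite -ge0_integralD//.
    - apply: eq_integral => w /[!inE] -[_ /= Zk].
      by rewrite addeCA subee ?adde0// ge0_fin_numE// (le_lt_trans Zk)// ltry.
    - exact: measurable_funTS.
    - by move=> w [/= /ltW ? Zk]; rewrite sube_ge0// ge0_fin_numE// (le_lt_trans Zk)// ltry.
    - by apply: measurable_funTS; exact: emeasurable_funB.
  have Z'fin : \int[P]_(w in N k) Z' w \is a fin_num.
    rewrite ge0_fin_numE; last exact: integral_ge0.
    apply: (@le_lt_trans _ _ (\int[P]_(w in N k) k%:R%:E)).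
      apply: ge0_le_integral => //; first exact: measurable_funTS.
      by move=> w [].
    rewrite integral_cst// -ge0_fin_numE ?mule_ge0//.
    by rewrite fin_numM// fin_num_measure.
  have D0 : \int[P]_(w in N k) `|Z w - Z' w| = 0.
    have Dge w : N k w -> 0 <= Z w - Z' w.
      by move=> [/= /ltW ? Zk]; rewrite sube_ge0// ge0_fin_numE// (le_lt_trans Zk)// ltry.
    have -> : \int[P]_(w in N k) `|Z w - Z' w| = \int[P]_(w in N k) (Z w - Z' w).
      by apply: eq_integral => w /[!inE] /Dge Dw; rewrite gee0_abs.
    apply/eqP; rewrite eq_le integral_ge0// andbT.
    have := ZZ' _ (mN k); rewrite intE -[leRHS]adde0.
    by rewrite leeD2lE.
  have mD : measurable_fun (N k) (fun w => Z w - Z' w).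
    by apply: measurable_funTS; exact: emeasurable_funB.
  move/(ae_eq_integral_abs _ mNW mD) : D0 => [B [mB PB NB]].
  apply/eqP; rewrite eq_le measure_ge0 andbT -PB le_measure ?inE// => w Nw.
  apply: NB => /= /(_ Nw) ZZ0.
  by case: Nw => /=; rewrite -sube_gt0 ZZ0 ltxx.
have mNW k : measurable (N k : set Om) := measurable_preimageW mY (mN k).
have : P.-negligible (\bigcup_k N k).
  by apply: negligible_bigcup => k; apply/negligibleP; [exact: mNW|exact: PN].
apply: negligibleS => w /= /negP; rewrite -ltNge => Zlt.
have Z'fin : Z' w \is a fin_num.
  by rewrite ge0_fin_numE// (lt_le_trans Zlt)// leey.
exists (Num.truncn (fine (Z' w))).+1 => //; split => //=.
by rewrite -(fineK Z'fin) lee_fin ltW// truncnS_gt.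
Qed.

Lemma ge0_cond_exp_unique (X Z Z' : Om -> \bar R) :
  is_cond_exp_ge0 P Y X Z -> is_cond_exp_ge0 P Y X Z' ->
  {ae P, forall w, Z w = Z' w}.
Proof.
move=> [Z0 mZ ZX] [Z'0 mZ' Z'X].
have le1 : {ae P, forall w, Z w <= Z' w}.
  by apply: ge0_preimage_ae_le => // A mA; rewrite ZX// Z'X.
have le2 : {ae P, forall w, Z' w <= Z w}.
  by apply: ge0_preimage_ae_le => // A mA; rewrite ZX// Z'X.
by apply: filterS2 le1 le2 => w ? ?; apply/eqP; rewrite eq_le; apply/andP.
Qed.

Lemma is_cond_exp_unique (X Z Z' : Om -> R) :
  is_cond_exp P Y X Z -> is_cond_exp P Y X Z' -> {ae P, forall w, Z w = Z' w}.
Proof.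
move=> [_ [Zp [Zn [Zp1 Zn1 ZE]]]] [_ [Zp' [Zn' [Zp1' Zn1' ZE']]]].
have Ep := ge0_cond_exp_unique Zp1 Zp1'.
have En := ge0_cond_exp_unique Zn1 Zn1'.
have ZZ : {ae P, forall w, Zp w - Zn w = Zp' w - Zn' w}.
  by apply: filterS2 Ep En => w -> ->.
by apply: filterS3 ZE ZE' ZZ => w Zw Z'w E; apply: EFin_inj; rewrite Zw Z'w.
Qed.

End conditional_expectation_theory.

(** * Existence by the Radon-Nikodym theorem *)

Section conditional_expectation_existence.
Context {d d'} {Om : measurableType d} {T' : measurableType d'} {R : realType}.
Variables (P : probability Om R) (Y : Om -> T').
Hypothesis mY : measurable_fun setT Y.
Local Notation G := (g_sigma_algebra_preimageType Y).
Local Open Scope ereal_scope.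
Variable W : Om -> R.
Hypothesis W0 : forall w, (0 <= W w)%R.
Hypothesis iW : P.-integrable setT (EFin \o W).

Let mpre (B : set T') : measurable B -> measurable (Y @^-1` B).
Proof. by move=> mB; rewrite -[X in measurable X]setTI; exact: mY. Qed.

Let nu (B : set T') := \int[P]_(w in Y @^-1` B) (W w)%:E.

Let nu0 : nu set0 = 0.
Proof. by rewrite /nu preimage_set0 integral_set0. Qed.

Let nu_ge0 B : 0 <= nu B.
Proof. by apply: integral_ge0 => w _; rewrite lee_fin. Qed.

Let nu_sigma_additive : semi_sigma_additive nu.
Proof.
move=> F mF tF mUF; rewrite /nu preimage_bigcup.
apply: (@semi_sigma_additive_nng_induced _ _ _ P (EFin \o W)).
- exact: measurable_int iW.
- by move=> w; rewrite lee_fin.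
- by move=> i; exact: mpre.
- apply/trivIsetP => /= i j _ _ ij; rewrite -preimage_setI.
  by move/trivIsetP : tF => /(_ _ _ _ _ ij) ->//; rewrite preimage_set0.
- by rewrite -preimage_bigcup; exact: mpre.
Qed.

HB.instance Definition _ := isMeasure.Build _ _ _ nu nu0 nu_ge0 nu_sigma_additive.

Let nu_fin : fin_num_fun nu.
Proof.
move=> B mB; apply: integrable_fin_num; first exact: mpre.
by apply: integrableS iW => //; exact: mpre.
Qed.

HB.instance Definition _ := @Measure_isFinite.Build _ _ _ nu nu_fin.

(** The finite measure [nu] is absolutely continuous with respect to the law of [Y]. Its density
    composed with [Y] is measurable for the sigma-algebra of [Y], and a change of variables turns
    its integrals over [B] into integrals over the preimage of [B]. *)
Lemma ge0_cond_exp_exists : exists Z : Om -> R,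
  [/\ forall w, (0 <= Z w)%R, measurable_fun setT (Z : G -> R) &
      forall A : set G, measurable A ->
        \int[P]_(w in A) (Z w)%:E = \int[P]_(w in A) (W w)%:E].
Proof.
pose Yf : {mfun Om >-> T'} := mfun_Sub (mem_set mY).
have numu : nu `<< distribution P Yf.
  apply/null_content_dominatesP => B mB PB; apply: null_set_integral => //.
  - exact: mpre.
  - by apply: measurable_funTS; exact: measurable_int iW.
have [f [f0 ffin intf fE]] := radon_nikodym_sigma_finite numu.
exists (fine \o f \o Y); split => [w| |A mA] /=.
- exact: fine_ge0.
- apply: measurable_preimage_comp.
  by apply: measurableT_comp => //; exact: measurable_int intf.
- have [B mB ->] := measurable_preimageE mA.
  rewrite -[RHS]/(nu B) fE// ge0_integral_pushforward//=.
  + by apply: eq_integral => w _; rewrite /= fineK.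
  + by apply: measurable_funTS; exact: measurable_int intf.
Qed.

End conditional_expectation_existence.

Section integrable_real.
Context {d} {Om : measurableType d} {R : realType}.
Variable P : probability Om R.
Local Open Scope ereal_scope.

Lemma integral_subr_eq0 (A : set Om) (f g : Om -> R) : measurable A ->
  P.-integrable setT (EFin \o f) -> P.-integrable setT (EFin \o g) ->
  (\int[P]_(w in A) (f w - g w)%:E = 0) <->
  (\int[P]_(w in A) (f w)%:E = \int[P]_(w in A) (g w)%:E).
Proof.
move=> mA /(integrableS measurableT mA (@subsetT _ A)) fi
  /(integrableS measurableT mA (@subsetT _ A)) gi.
under eq_integral do rewrite EFinB.
rewrite (integralB_EFin mA fi gi).
have ffin := integrable_fin_num mA fi; have gfin := integrable_fin_num mA gi.
split; first by move=> /eqP; rewrite sube_eq ?add0e ?fin_num_adde_defl// => /eqP.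
by move=> ->; rewrite subee.
Qed.

Lemma integrable_bounded_mul (g f : Om -> R) : measurable_fun setT g ->
  (exists M, forall w, `|g w| <= M)%R ->
  P.-integrable setT (EFin \o f) -> P.-integrable setT (EFin \o (g \* f)%R).
Proof.
move=> mg [M gM] fi.
apply: (integrableMr measurableT mg _ fi).
exists M; split; first by rewrite num_real.
by move=> x Mx w _ /=; rewrite (le_trans (gM w))// ltW.
Qed.

Lemma bounded_indic_mul (A : set Om) (g : Om -> R) :
  (exists M, forall w, `|g w| <= M)%R -> (exists M, forall w, `|\1_A w * g w| <= M)%R.
Proof.
move=> [M gM]; exists M => w; rewrite indicE; case: (_ \in _).
  by rewrite mul1r.
by rewrite mul0r normr0 (le_trans _ (gM w)).
Qed.

Lemma integral_indic_mul (A : set Om) (f : Om -> R) : measurable A ->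
  \int[P]_(w in A) (f w)%:E = \int[P]_w (\1_A w * f w)%:E.
Proof.
move=> mA; rewrite integral_mkcond; apply: eq_integral => w _.
by rewrite epatch_indic EFinM muleC.
Qed.

End integrable_real.

Lemma funrposBnegE (T : Type) (R : realDomainType) (f : T -> R) x :
  f x = f^\+ x - f^\- x.
Proof. by have /(congr1 (@^~ x)) := funrposBneg f. Qed.

(** * Conditional expectations of integrable and of weighted integrable variables *)

Section integrable_version.
Context {d d'} {Om : measurableType d} {T' : measurableType d'} {R : realType}.
Variables (P : probability Om R) (Y : Om -> T').
Hypothesis mY : measurable_fun setT Y.
Local Notation G := (g_sigma_algebra_preimageType Y).
Local Open Scope ereal_scope.

(** The classical conditional expectation of an integrable variable. It is linear in [W] and
    therefore easier to handle than [is_cond_exp], to which it is related below. *)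
Definition integrable_version (W Z : Om -> R) :=
  [/\ measurable_fun setT (Z : G -> R), P.-integrable setT (EFin \o Z) &
      forall A : set G, measurable A ->
        \int[P]_(w in A) (Z w)%:E = \int[P]_(w in A) (W w)%:E].

(* Moving negative parts across the equation [\int Z = \int W] makes the results
   for nonnegative functions applicable. *)
Lemma integral_posneg_cross (W Z : Om -> R) :
  P.-integrable setT (EFin \o W) -> P.-integrable setT (EFin \o Z) ->
  forall A : set Om, measurable A ->
    \int[P]_(w in A) (Z w)%:E = \int[P]_(w in A) (W w)%:E ->
  \int[P]_(w in A) ((Z^\+ w + W^\- w)%R)%:E =
  \int[P]_(w in A) ((W^\+ w + Z^\- w)%R)%:E.
Proof.
move=> iW iZ A mA ZW.
have iW1 := integrable_funrpos measurableT iW.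
have iW2 := integrable_funrneg measurableT iW.
have iZ1 := integrable_funrpos measurableT iZ.
have iZ2 := integrable_funrneg measurableT iZ.
apply/integral_subr_eq0 => //.
- exact: (integrableD measurableT iZ1 iW2).
- exact: (integrableD measurableT iW1 iZ2).
rewrite -(iffRL (integral_subr_eq0 mA iZ iW) ZW); apply: eq_integral => w _.
congr EFin; rewrite [in RHS](funrposBnegE W) [in RHS](funrposBnegE Z); ring.
Qed.

(** The nonnegative functions [Z^+ + Z'^-] and [Z'^+ + Z^-] have the same integrals over the
    sigma-algebra of [Y], so the comparison of nonnegative functions applies in both directions. *)
Lemma integrable_version_unique (W Z Z' : Om -> R) :
  integrable_version W Z -> integrable_version W Z' ->
  {ae P, forall w, Z w = Z' w}.
Proof.
move=> [mZ iZ ZW] [mZ' iZ' Z'W].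
have E (A : set G) : measurable A -> \int[P]_(w in A) (Z w)%:E = \int[P]_(w in A) (Z' w)%:E.
  by move=> mA; rewrite ZW// Z'W.
have mp (f : Om -> R) : measurable_fun setT (f : G -> R) ->
  measurable_fun setT (f^\+%R : G -> R) by exact: measurable_funrpos.
have mn (f : Om -> R) : measurable_fun setT (f : G -> R) ->
  measurable_fun setT (f^\-%R : G -> R) by exact: measurable_funrneg.
pose u w := (Z^\+ w + Z'^\- w)%R; pose v w := (Z'^\+ w + Z^\- w)%R.
have mu : measurable_fun setT (u : G -> R).
  by apply: measurable_funD; [exact: mp|exact: mn].
have mv : measurable_fun setT (v : G -> R).
  by apply: measurable_funD; [exact: mp|exact: mn].
have uv (A : set G) : measurable A ->
    \int[P]_(w in A) (u w)%:E = \int[P]_(w in A) (v w)%:E.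
  move=> mA; apply: integral_posneg_cross => //; last exact: E.
  exact: measurable_preimageW mA.
have u0 w : 0 <= (u w)%:E by rewrite lee_fin addr_ge0// ?funrpos_ge0 ?funrneg_ge0.
have v0 w : 0 <= (v w)%:E by rewrite lee_fin addr_ge0// ?funrpos_ge0 ?funrneg_ge0.
have le1 : {ae P, forall w, (u w)%:E <= (v w)%:E}.
  by apply: (ge0_preimage_ae_le mY) => //; [exact/measurable_EFinP..|move=> A mA; rewrite uv].
have le2 : {ae P, forall w, (v w)%:E <= (u w)%:E}.
  by apply: (ge0_preimage_ae_le mY) => //; [exact/measurable_EFinP..|move=> A mA; rewrite uv].
apply: filterS2 le1 le2 => w; rewrite !lee_fin => a b.
have {a b} : u w = v w by apply/eqP; rewrite eq_le a b.
by rewrite /u /v => E'; rewrite [LHS]funrposBnegE [RHS]funrposBnegE; lra.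
Qed.

(** With [k = 1_A g], the difference [k Z - k W] equals [k (u - v)] for nonnegative [u] and [v].
    Splitting [k] into its positive and negative parts leaves nonnegative products, to which
    [ge0_pull_out] applies; boundedness of [g] keeps all integrals finite. *)
Lemma integrable_version_pull_out (W Z g : Om -> R) :
  P.-integrable setT (EFin \o W) -> integrable_version W Z ->
  measurable_fun setT (g : G -> R) -> (exists M, forall w, `|g w| <= M)%R ->
  integrable_version (g \* W)%R (g \* Z)%R.
Proof.
move=> iW [mZ iZ ZW] mg gM.
have mgW : measurable_fun (setT : set Om) g := measurable_fun_preimageW mY mg measurableT.
split; [exact: measurable_funM|exact: integrable_bounded_mul|].
move=> A mA; have mAW : measurable (A : set Om) := measurable_preimageW mY mA.
rewrite [LHS]integral_indic_mul// [RHS]integral_indic_mul//.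
pose k w := (\1_A w * g w)%R.
have mk : measurable_fun setT (k : G -> R).
  by apply: measurable_funM => //; exact: (@measurable_indic _ G).
have kM : (exists M, forall w, `|k w| <= M)%R by exact: bounded_indic_mul.
have mkW : measurable_fun (setT : set Om) k := measurable_fun_preimageW mY mk measurableT.
under eq_integral do rewrite mulrA.
under [RHS]eq_integral do rewrite mulrA.
pose u w := (Z^\+ w + W^\- w)%R; pose v w := (W^\+ w + Z^\- w)%R.
have iu : P.-integrable setT (EFin \o u).
  exact: (integrableD measurableT (integrable_funrpos measurableT iZ)
    (integrable_funrneg measurableT iW)).
have iv : P.-integrable setT (EFin \o v).
  exact: (integrableD measurableT (integrable_funrpos measurableT iW)
    (integrable_funrneg measurableT iZ)).
have kuv (l : Om -> R) : measurable_fun setT (l : G -> R) -> (forall w, 0 <= l w)%R ->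
    \int[P]_w (l w * u w)%:E = \int[P]_w (l w * v w)%:E.
  move=> ml l0; apply: (ge0_pull_out mY) => //.
  - by apply/measurable_EFinP; exact: measurable_int iu.
  - by apply/measurable_EFinP; exact: measurable_int iv.
  - by move=> w; rewrite addr_ge0// ?funrpos_ge0 ?funrneg_ge0.
  - by move=> w; rewrite addr_ge0// ?funrpos_ge0 ?funrneg_ge0.
  - move=> B mB; apply: integral_posneg_cross => //; last exact: ZW.
    exact: measurable_preimageW mB.
have mkp : measurable_fun setT (k^\+%R : G -> R) by exact: measurable_funrpos.
have mkn : measurable_fun setT (k^\-%R : G -> R) by exact: measurable_funrneg.
have mkpW : measurable_fun (setT : set Om) k^\+%R := measurable_fun_preimageW mY mkp measurableT.
have mknW : measurable_fun (setT : set Om) k^\-%R := measurable_fun_preimageW mY mkn measurableT.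
have kabs w : (k^\+ w + k^\- w = `|k w|)%R by have /(congr1 (@^~ w)) := funrposDneg k.
have kpM : (exists M, forall w, `|k^\+ w| <= M)%R.
  have [M kM'] := kM; exists M => w; rewrite (le_trans _ (kM' w))// -kabs.
  by rewrite ger0_norm ?funrpos_ge0// lerDl funrneg_ge0.
have knM : (exists M, forall w, `|k^\- w| <= M)%R.
  have [M kM'] := kM; exists M => w; rewrite (le_trans _ (kM' w))// -kabs.
  by rewrite ger0_norm ?funrneg_ge0// lerDr funrpos_ge0.
apply/integral_subr_eq0 => //; [exact: integrable_bounded_mul..|].
transitivity (\int[P]_w ((k^\+ w * u w - k^\+ w * v w) - (k^\- w * u w - k^\- w * v w))%:E).
  apply: eq_integral => w _; congr EFin.
  rewrite -[LHS]/(k w * Z w - k w * W w)%R.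
  by rewrite [k w]funrposBnegE [Z w]funrposBnegE [W w]funrposBnegE /u /v; ring.
have ip (l v' : Om -> R) : measurable_fun setT l -> (exists M, forall w, `|l w| <= M)%R ->
  P.-integrable setT (EFin \o v') -> P.-integrable setT (EFin \o (l \* v')%R).
  by move=> *; exact: integrable_bounded_mul.
have lE (l : Om -> R) : measurable_fun setT l -> (exists M, forall w, `|l w| <= M)%R ->
    \int[P]_w (l w * u w)%:E = \int[P]_w (l w * v w)%:E ->
    \int[P]_w (l w * u w - l w * v w)%:E = 0.
  by move=> ml lM /(iffRL (integral_subr_eq0 measurableT (ip _ _ ml lM iu) (ip _ _ ml lM iv))).
have iB (l : Om -> R) : measurable_fun setT l -> (exists M, forall w, `|l w| <= M)%R ->
    P.-integrable setT (EFin \o (l \* u \- l \* v)%R).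
  by move=> ml lM; exact: (integrableB measurableT (ip _ _ ml lM iu) (ip _ _ ml lM iv)).
apply: (iffRL (integral_subr_eq0 measurableT (iB _ mkpW kpM) (iB _ mknW knM))) => /=.
by rewrite !lE//; apply: kuv => //.
Qed.

Lemma integrable_version_exists (W : Om -> R) : P.-integrable setT (EFin \o W) ->
  exists Zp Zn : Om -> R,
  [/\ forall w, (0 <= Zp w)%R, forall w, (0 <= Zn w)%R,
      integrable_version W^\+%R Zp & integrable_version W^\-%R Zn].
Proof.
have H (V : Om -> R) : (forall w, 0 <= V w)%R -> P.-integrable setT (EFin \o V) ->
    exists2 Z : Om -> R, forall w, (0 <= Z w)%R & integrable_version V Z.
  move=> V0 iV; have [Z [Z0 mZ ZV]] := ge0_cond_exp_exists mY V0 iV.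
  have mZW : measurable_fun (setT : set Om) Z := measurable_fun_preimageW mY mZ measurableT.
  exists Z => //; split => //.
  apply/integrableP; split; first exact/measurable_EFinP.
  under eq_integral do rewrite /= ger0_norm//.
  rewrite ZV; last exact: (@measurableT _ G).
  exact: integrable_lty.
move=> iW; have [Zp Zp0 vZp] := H _ (funrpos_ge0 W) (integrable_funrpos measurableT iW).
have [Zn Zn0 vZn] := H _ (funrneg_ge0 W) (integrable_funrneg measurableT iW).
by exists Zp, Zn.
Qed.

Lemma integrable_versionB (V W Z Z' : Om -> R) :
  P.-integrable setT (EFin \o V) -> P.-integrable setT (EFin \o W) ->
  integrable_version V Z -> integrable_version W Z' ->
  integrable_version (V \- W)%R (Z \- Z')%R.
Proof.
move=> iV iW [mZ iZ ZV] [mZ' iZ' Z'W]; split.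
- exact: measurable_funB.
- exact: (integrableB measurableT iZ iZ').
- move=> A mA; have mAW : measurable (A : set Om) := measurable_preimageW mY mA.
  have S (f : Om -> R) : P.-integrable setT (EFin \o f) -> P.-integrable A (EFin \o f).
    by move=> fi; exact: integrableS fi.
  under eq_integral do rewrite EFinB; rewrite (integralB_EFin mAW (S _ iZ) (S _ iZ')).
  under [RHS]eq_integral do rewrite EFinB; rewrite (integralB_EFin mAW (S _ iV) (S _ iW)).
  by rewrite ZV// Z'W.
Qed.

(** Here [X] itself may fail to be integrable. Since [h > 0], the positive and negative parts of
    [h X] are [h] times those of [X], and [ge0_pull_out] with the factor [1 / h] turns their
    conditional expectations into those of the parts of [X]. *)
Lemma is_cond_exp_weighted (X h Z : Om -> R) :
  measurable_fun setT X ->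
  measurable_fun setT ((fun w => (h w)^-1%R) : G -> R) ->
  (forall w, 0 < h w)%R -> P.-integrable setT (EFin \o (h \* X)%R) ->
  integrable_version (h \* X)%R Z ->
  is_cond_exp P Y X (fun w => Z w / h w)%R.
Proof.
move=> mX hV h0 ihX vZ; have [mZ iZ ZX] := vZ.
have [Zp [Zn [Zp0 Zn0 vZp vZn]]] := integrable_version_exists ihX.
split; first exact: measurable_funM.
exists (fun w => (Zp w / h w)%:E), (fun w => (Zn w / h w)%:E).
have K (V : Om -> R) (Zv : Om -> R) (X' : Om -> \bar R) :
    (forall w, 0 <= Zv w)%R -> (forall w, 0 <= V w)%R -> measurable_fun setT V ->
    (forall w, X' w = (V w / h w)%:E) -> integrable_version V Zv ->
    is_cond_exp_ge0 P Y X' (fun w => (Zv w / h w)%:E).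
  move=> Zv0 V0 mV XE [mZv iZv ZvV]; split.
  - by move=> w; rewrite lee_fin divr_ge0// ltW.
  - by apply/measurable_EFinP; exact: measurable_funM.
  - move=> A mA; have mAW : measurable (A : set Om) := measurable_preimageW mY mA.
    under [RHS]eq_integral do rewrite XE.
    rewrite [LHS]integral_indic_mul// [RHS]integral_indic_mul//.
    under eq_integral do rewrite (mulrC (Zv _)) mulrA.
    under [RHS]eq_integral do rewrite (mulrC (V _)) mulrA.
    apply: (ge0_pull_out mY) => //.
    + exact: (@measurable_fun_preimageW _ _ _ _ _ mY _ _ setT _ mZv measurableT).
    + by apply: measurable_funM => //; exact: (@measurable_indic _ G).
    + by move=> w; rewrite mulr_ge0// invr_ge0 ltW.
have mhX : measurable_fun setT (h \* X)%R by apply/measurable_EFinP; exact: measurable_int ihX.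
split.
- apply: (K _ _ _ Zp0 (funrpos_ge0 _) (measurable_funrpos mhX) _ vZp) => w.
  rewrite funeposE /funrpos /= -EFin_max; congr EFin.
  by rewrite -[0%R in RHS](mulr0 (h w)) -maxr_pMr ?ltW// mulrAC divff ?mul1r// gt_eqF.
- apply: (K _ _ _ Zn0 (funrneg_ge0 _) (measurable_funrneg mhX) _ vZn) => w.
  rewrite funenegE /funrneg /= -EFin_max; congr EFin.
  by rewrite -mulrN -[0%R in RHS](mulr0 (h w)) -maxr_pMr ?ltW// mulrAC divff ?mul1r// gt_eqF.
(* The given [Z] need not be [Zp - Zn], but uniqueness makes them agree almost everywhere, which is
   all that [is_cond_exp] asks. *)
- have vB : integrable_version (h \* X)%R (Zp \- Zn)%R.
    rewrite -[X in integrable_version X]funrposBneg.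
    by apply: integrable_versionB => //; [exact: integrable_funrpos|exact: integrable_funrneg].
  apply: filterS (integrable_version_unique vZ vB) => w ->.
  by rewrite -EFinB mulrBl.
Qed.

Lemma is_cond_exp_integrable (W Z : Om -> R) :
  P.-integrable setT (EFin \o W) -> integrable_version W Z -> is_cond_exp P Y W Z.
Proof.
move=> iW vZ; have WE : W = (cst 1 \* W)%R by apply/funext => w; rewrite /= mul1r.
have -> : Z = (fun w => Z w / (cst 1 w))%R by apply/funext => w; rewrite divr1.
apply: is_cond_exp_weighted; rewrite -?WE//; last exact: (@measurable_cst _ _ G R setT (1^-1)%R).
by apply/measurable_EFinP; exact: measurable_int iW.
Qed.

Lemma cond_exp_ae (X Z : Om -> R) : is_cond_exp P Y X Z ->
  {ae P, forall w, cond_exp P Y X w = Z w}.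
Proof.
move=> XZ; apply: (is_cond_exp_unique mY _ XZ).
by apply: (@xgetPex _ _ [set V | is_cond_exp P Y X V]); exists Z.
Qed.

(** The chosen version agrees almost everywhere with the integrable [Zp - Zn], which transfers
    integrability and the integral identity to it. *)
Lemma cond_exp_integrable_version (W : Om -> R) :
  P.-integrable setT (EFin \o W) -> integrable_version W (cond_exp P Y W).
Proof.
move=> iW; have [Zp [Zn [Zp0 Zn0 vZp vZn]]] := integrable_version_exists iW.
have vB : integrable_version W (Zp \- Zn)%R.
  rewrite -[W]funrposBneg.
  by apply: integrable_versionB => //; [exact: integrable_funrpos|exact: integrable_funrneg].
have cB := is_cond_exp_integrable iW vB.
have E := cond_exp_ae cB.
have mC : measurable_fun setT (cond_exp P Y W : G -> R).
  (* Measurability does not follow from almost everywhere equality; it holds for any version and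
     also for the default value zero. *)
  by rewrite /cond_exp; case: xgetP => [V _ []|_] //.
have mCW : measurable_fun (setT : set Om) (cond_exp P Y W) :=
  measurable_fun_preimageW mY mC measurableT.
have [_ iB BW] := vB.
have mB := measurable_int _ iB.
split => // [|A mA].
  apply/integrableP; split; first exact/measurable_EFinP.
  rewrite (ae_eq_integral (fun w => `|((Zp \- Zn)%R w)%:E|)) => //.
  - by case/integrableP : iB.
  - by apply/measurableT_comp => //; exact/measurable_EFinP.
  - exact/measurableT_comp.
  - by apply: filterS E => w + _ /= => ->.
have mAW : measurable (A : set Om) := measurable_preimageW mY mA.
rewrite -BW//; apply: ae_eq_integral => //.
- by apply/measurable_EFinP; exact: measurable_funTS.
- exact: measurable_funTS.
- by apply: filterS E => w + _ /= => ->.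
Qed.

End integrable_version.

(** * Jacobians and first-order conditions *)

Section inner_product.
Context {R : realType}.

Lemma innerE n (x y : 'cV[R]_n) : inner x y = (x^T *m y) 0 0.
Proof. by rewrite mxE; apply: eq_bigr => i _; rewrite mxE. Qed.

Lemma inner_mulmx n m (A : 'M[R]_(n, m)) (x : 'cV[R]_n) (y : 'cV[R]_m) :
  inner (A^T *m x) y = inner x (A *m y).
Proof. by rewrite !innerE trmx_mul trmxK mulmxA. Qed.

Lemma inner_ge0 n (x : 'cV[R]_n) : 0 <= inner x x.
Proof. by apply: sumr_ge0 => i _; rewrite -expr2 sqr_ge0. Qed.

Lemma enorm_sqr n (x : 'cV[R]_n) : enorm x ^+ 2 = inner x x.
Proof. by rewrite sqr_sqrtr// inner_ge0. Qed.

Lemma innerNl n (x y : 'cV[R]_n) : inner (- x) y = - inner x y.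
Proof. by rewrite !innerE linearN mulNmx mxE. Qed.

Lemma innerNr n (x y : 'cV[R]_n) : inner x (- y) = - inner x y.
Proof. by rewrite !innerE mulmxN mxE. Qed.

Lemma innerDr n (x y z : 'cV[R]_n) : inner x (y + z) = inner x y + inner x z.
Proof. by rewrite !innerE mulmxDr mxE. Qed.

Lemma innerZr n a (x y : 'cV[R]_n) : inner x (a *: y) = a * inner x y.
Proof. by rewrite !innerE -scalemxAr mxE. Qed.

Lemma innerC n (x y : 'cV[R]_n) : inner x y = inner y x.
Proof. by apply: eq_bigr => i _; rewrite mulrC. Qed.

Lemma inner_eq0 n (x : 'cV[R]_n) : (forall h, 0 <= inner x h) -> x = 0.
Proof.
move=> x0; have /eqP : inner x x == 0.
  by rewrite eq_le inner_ge0 andbT; have := x0 (- x); rewrite innerNr oppr_ge0.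
move/eqP; rewrite psumr_eq0 => [/allP xx|i _]; last by rewrite -expr2 sqr_ge0.
apply/matrixP => i j; rewrite ord1 mxE.
by have := xx i (mem_index_enum _); rewrite /= -expr2 sqrf_eq0 => /eqP.
Qed.

End inner_product.

Section borel.
Context {R : realType}.

Lemma measurable_continuous_cV n (g : 'cV[R]_n -> R) :
  continuous g -> measurable_fun setT g.
Proof.
move=> cg; apply: (measurability _ (RGenOpens.measurableE R)) => _ [_ [a [b ->]] <-].
rewrite setTI; apply: sub_sigma_algebra.
by apply: open_comp => // x _; exact: cg.
Qed.

Lemma measurable_continuous_cV_cV n m (g : 'cV[R]_n -> 'cV[R]_m) :
  continuous g -> measurable_fun setT g.
Proof.
move=> cg; apply: (measurability (@open 'cV[R]_m)) => // _ [B oB <-].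
rewrite setTI; apply: sub_sigma_algebra.
by apply: open_comp => // x _; exact: cg.
Qed.

Lemma measurable_coord_cV n (i : 'I_n) : measurable_fun setT (fun x : 'cV[R]_n => x i 0).
Proof. by apply: measurable_continuous_cV => x; exact: coord_continuous. Qed.

End borel.

Section jacobians.
Context {R : realType}.

(** A named map, with values in [R^o], so that it can carry a linear structure and its differential
    can be computed as that of a linear map. *)
Definition coordinate n (i : 'I_n) (x : 'cV[R]_n) : R^o := x i 0.

Fact coordinate_is_linear n (i : 'I_n) : linear (coordinate i).
Proof. by move=> a x y; rewrite /coordinate !mxE. Qed.

HB.instance Definition _ n (i : 'I_n) :=
  GRing.isLinear.Build R 'cV[R]_n R^o _ (coordinate i) (coordinate_is_linear i).

Lemma coordinate_continuous n (i : 'I_n) : continuous (coordinate i).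
Proof. by move=> x; exact: coord_continuous. Qed.

(** This is the bridge between the matrix of partial derivatives and the differential: expand [v] in
    the standard basis and use linearity of the differential. *)
Lemma jac_mul k l (g : 'cV[R]_k -> 'cV[R]_l) x v :
  differentiable g x -> jac g x *m v = 'd g x v.
Proof.
move=> dg; apply/matrixP => i j; rewrite ord1 {j} mxE.
have E h : 'D_h (coordinate i \o g) x = ('d g x h) i 0.
  have dc y : differentiable (coordinate i) y.
    by apply: linear_differentiable; exact: coordinate_continuous.
  rewrite deriveE; last exact: differentiable_comp.
  by rewrite diff_comp//= diff_lin//; exact: coordinate_continuous.
under eq_bigr => j _ do rewrite mxE [X in X * _]E.
rewrite [in RHS](matrix_sum_delta v).
rewrite linear_sum summxE; apply: eq_bigr => j _.
by rewrite big_ord1 linearZ !mxE mulrC.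
Qed.

Lemma jac_eq k l (g : 'cV[R]_k -> 'cV[R]_l) x (M : 'M[R]_(l, k)) :
  differentiable g x -> (forall v, 'd g x v = M *m v) -> jac g x = M.
Proof.
move=> dg gM; apply/matrixP => i j.
have := jac_mul (delta_mx j 0) dg; rewrite gM -!colE => /matrixP/(_ i 0).
by rewrite !mxE.
Qed.

Lemma jac_comp k l p (f : 'cV[R]_k -> 'cV[R]_l) (g : 'cV[R]_l -> 'cV[R]_p) x :
  differentiable f x -> differentiable g (f x) ->
  jac (g \o f) x = jac g (f x) *m jac f x.
Proof.
move=> df dg; apply: jac_eq => [|v]; first exact: differentiable_comp.
by rewrite diff_comp//= -mulmxA !jac_mul.
Qed.

Section partial.
Context {n m : nat}.
Variable f : 'cV[R]_n * 'cV[R]_m -> 'cV[R]_n.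

Lemma diff_partial_x z : differentiable f z ->
  differentiable (fun x => f (x, z.2)) z.1 /\
  forall h, jac_x f z *m h = 'd f z (h, 0).
Proof.
case: z => x u df /=.
have dp : differentiable (fun y : 'cV[R]_n => (y, u)) x.
  by apply: differentiable_pair; [exact: ex_diff|exact: differentiable_cst].
have dfp : differentiable (f \o (fun y : 'cV[R]_n => (y, u))) x.
  exact: differentiable_comp.
split=> // h; rewrite /jac_x jac_mul// -[fun _ => _]/(f \o (fun y => (y, u))).
rewrite diff_comp//= diff_pair//.
by rewrite diff_cst /= diff_val.
Qed.

Lemma diff_partial_u z : differentiable f z ->
  differentiable (fun u => f (z.1, u)) z.2 /\
  forall h, jac_u f z *m h = 'd f z (0, h).
Proof.
case: z => x u df /=.
have dp : differentiable (fun y : 'cV[R]_m => (x, y)) u.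
  by apply: differentiable_pair; [exact: differentiable_cst|exact: ex_diff].
have dfp : differentiable (f \o (fun y : 'cV[R]_m => (x, y))) u.
  exact: differentiable_comp.
split=> // h; rewrite /jac_u jac_mul// -[fun _ => _]/(f \o (fun y => (x, y))).
rewrite diff_comp//= diff_pair//.
by rewrite diff_cst /= diff_val.
Qed.

Lemma jac_feedback (phi : 'cV[R]_n -> 'cV[R]_m) x :
  differentiable phi x -> differentiable f (x, phi x) ->
  differentiable (fun y => f (y, phi y)) x /\
  jac (fun y => f (y, phi y)) x =
  jac_x f (x, phi x) + jac_u f (x, phi x) *m jac phi x.
Proof.
move=> dphi df.
have di : differentiable (fun y : 'cV[R]_n => y) x by exact: ex_diff.
have dp : differentiable (fun y => (y, phi y)) x by exact: differentiable_pair.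
have dc : differentiable (f \o (fun y => (y, phi y))) x by exact: differentiable_comp.
split=> //; apply: jac_eq => // v.
rewrite -[fun _ => _]/(f \o (fun y => (y, phi y))) diff_comp//= diff_pair//.
rewrite mulmxDl -mulmxA (diff_partial_x df).2 (diff_partial_u df).2 -linearD /=.
have -> : ((v, 0) : 'cV[R]_n * 'cV[R]_m) + (0, jac phi x *m v) = (v, 'd phi x v).
  by rewrite jac_mul//; congr pair; rewrite /= ?addr0 ?add0r.
by rewrite diff_val.
Qed.

End partial.

Lemma sum_continuous (T : topologicalType) (I : Type) (r : seq I) (F : I -> T -> R) :
  (forall i, continuous (F i)) -> continuous (fun x => \sum_(i <- r) F i x).
Proof. by move=> cF; apply: continuous_big => //; exact: add_continuous. Qed.

Lemma inner_continuous n (q : 'cV[R]_n) : continuous (inner q : 'cV[R]_n -> R).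
Proof.
apply: sum_continuous => i x.
apply: (@continuousM _ _ (cst (q i 0)) (fun x : 'cV[R]_n => x i 0)); first exact: cst_continuous.
exact: coord_continuous.
Qed.

Lemma inner_diag_continuous n : continuous (fun x : 'cV[R]_n => inner x x : R).
Proof.
apply: sum_continuous => i x.
by apply: (@continuousM _ _ (fun x : 'cV[R]_n => x i 0) (fun x : 'cV[R]_n => x i 0));
  exact: coord_continuous. Qed.

(* The quadratic term is negligible after division by the step [(k + 1)^-1]. *)
Lemma first_order_condition n m (F : 'cV[R]_m -> 'cV[R]_n) u h q :
  differentiable F u ->
  (forall k : nat, let D := F (u + k.+1%:R^-1 *: h) - F u in
    0 <= inner q D + 2^-1 * inner D D) ->
  0 <= inner q (jac F u *m h).
Proof.
move=> dF opt; rewrite jac_mul// -deriveE//.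
pose D k := k.+1%:R *: (F (u + k.+1%:R^-1 *: h) - F u).
have cD : D k @[k --> \oo] --> 'D_h F u.
  have dv : derivable F u h by exact: diff_derivable.
  (* The derivative is a limit over punctured neighbourhoods, so it matters that the steps never
     vanish. *)
  have h0 : @harmonic R k @[k --> \oo] --> 0^'.
    move=> A /(@cvg_harmonic R); rewrite /nbhs/= => -[N _ NA].
    by exists N => // k Nk; apply: NA => //=; rewrite gt_eqF// harmonic_gt0.
  have := cvg_comp _ _ h0 dv; apply: cvg_trans; apply: near_eq_cvg.
  by apply: nearW => k; rewrite /= invrK [_ + u]addrC.
(* The expression under the limit is that of [opt k] multiplied by [k + 1], hence nonnegative. *)
have c2 : (inner q (D k) + 2^-1 * (k.+1%:R^-1 * inner (D k) (D k))) @[k --> \oo] -->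
    inner q ('D_h F u).
  rewrite -[X in _ --> X]addr0; apply: cvgD.
    exact: (cvg_comp _ _ cD (inner_continuous (q := q) (x := 'D_h F u))).
  rewrite -(mulr0 2^-1) -(mul0r (inner ('D_h F u) ('D_h F u))).
  apply: cvgM; first exact: cvg_cst.
  apply: cvgM; first exact: cvg_harmonic.
  exact: (cvg_comp _ _ cD (inner_diag_continuous (x := 'D_h F u))).
apply: (cvgr_to_ge c2); apply: nearW => k; have /= := opt k; rewrite /D.
set d := F _ - F _ => dk.
rewrite !innerZr [inner (_ *: d) _]innerC innerZr [k.+1%:R^-1 * _]mulrA.
rewrite mulVf ?pnatr_eq0// mul1r mulrCA -mulrDr mulr_ge0//.
Qed.

(** As [phi] takes its values in [U], the function [z |-> <y, phi z>] is maximal at [x] over the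
    whole space, so its gradient vanishes there. *)
Lemma normal_cone_tangent n m (U : set 'cV[R]_m) (phi : 'cV[R]_n -> 'cV[R]_m) x y :
  differentiable phi x -> (forall z, U (phi z)) -> normal_cone U (phi x) y ->
  (jac phi x)^T *m y = 0.
Proof.
move=> dphi phiU Ny; apply: inner_eq0 => h.
(* Two sign changes bring the goal to the first-order condition for [q = - y] in the direction
   [- h]. *)
rewrite inner_mulmx -[h]opprK mulmxN innerNr -innerNl.
apply: first_order_condition => // k /=.
rewrite addr_ge0//; first by rewrite innerNl oppr_ge0; exact: Ny.
by rewrite mulr_ge0// inner_ge0.
Qed.

End jacobians.

(** * First variation of a minimizer *)

Section variational.
Context {d d'} {Om : measurableType d} {T' : measurableType d'} {R : realType}.
Variables (P : probability Om R) (Y : Om -> T').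
Hypothesis mY : measurable_fun setT Y.
Local Notation G := (g_sigma_algebra_preimageType Y).
Local Open Scope ereal_scope.

Lemma nonpositive_integral_ae_eq0 (f : Om -> R) : P.-integrable setT (EFin \o f) ->
  (forall w, f w <= 0)%R -> 0 <= \int[P]_w (f w)%:E -> {ae P, forall w, f w = 0%R}.
Proof.
move=> fi f0 If.
have mf := measurable_int _ fi.
have : \int[P]_w `|(f w)%:E| = 0.
  transitivity (\int[P]_w - (f w)%:E).
    by apply: eq_integral => w _; rewrite /= ler0_norm.
  have -> : \int[P]_w - (f w)%:E = - \int[P]_w (f w)%:E.
    by rewrite integralN//; exact: (integrable_add_def measurableT fi).
  apply/eqP; rewrite eq_le oppe_le0 If/=.
  have <- : \int[P]_w - (f w)%:E = - \int[P]_w (f w)%:E.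
    by rewrite integralN//; exact: (integrable_add_def measurableT fi).
  by apply: integral_ge0 => w _; rewrite oppe_ge0 lee_fin.
move/(ae_eq_integral_abs _ measurableT mf).
by apply: filterS => w /(_ I) []//.
Qed.

(** The majorant is [1 + f^2]; constants are integrable because the measure is finite. *)
Lemma integrable_sqr (f : Om -> R) : measurable_fun setT f ->
  \int[P]_w (f w ^+ 2)%:E < +oo -> P.-integrable setT (EFin \o f).
Proof.
move=> mf f2; have i1 : P.-integrable setT (EFin \o (fun w => 1 + f w ^+ 2)%R).
  apply: (integrableD measurableT (f := EFin \o cst 1%R)
    (g := EFin \o (fun w => f w ^+ 2)%R)).
    exact: finite_measure_integrable_cst.
  apply/integrableP; split; first by apply/measurable_EFinP; exact: measurable_funX.
  by under eq_integral do rewrite /= ger0_norm ?sqr_ge0//.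
apply: (le_integrable measurableT _ _ i1); first exact/measurable_EFinP.
move=> w _; rewrite /= lee_fin [leRHS]ger0_norm ?addr_ge0 ?sqr_ge0//.
by rewrite -real_normK ?num_real//; nra.
Qed.

Lemma integrable_coord n (W : Om -> 'cV[R]_n) :
  (forall i, measurable_fun setT (fun w => W w i 0%R)) ->
  \int[P]_w (inner (W w) (W w))%:E < +oo ->
  forall i, P.-integrable setT (EFin \o (fun w => W w i 0%R)).
Proof.
move=> mW W2 i; apply: integrable_sqr => //; apply: le_lt_trans W2.
apply: ge0_le_integral => //.
- by move=> w _; rewrite lee_fin sqr_ge0.
- by apply/measurable_EFinP; exact: measurable_funX.
- apply/measurable_EFinP; apply: measurable_sum => j.
  exact: measurable_funM.
- move=> w _; rewrite lee_fin /inner (bigD1 i)//= -expr2 lerDl.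
  by apply: sumr_ge0 => j _; rewrite -expr2 sqr_ge0.
Qed.

(* Apply optimality to the set where [D] is bounded by [K] and the claimed
   inequality fails. *)
Lemma minimizer_first_variation n (W : Om -> 'cV[R]_n) (D : T' -> 'cV[R]_n) :
  (forall i, measurable_fun setT (fun w => W w i 0%R)) ->
  \int[P]_w (inner (W w) (W w))%:E < +oo ->
  (forall i, measurable_fun setT (fun y => D y i 0%R)) ->
  (forall B, measurable B -> \int[P]_w (inner (W w) (W w))%:E <=
    \int[P]_w (inner (W w + \1_B (Y w) *: D (Y w))%R (W w + \1_B (Y w) *: D (Y w))%R)%:E) ->
  {ae P, forall w, 0 <= inner (vcond_exp P Y W w) (D (Y w)) +
    2^-1 * inner (D (Y w)) (D (Y w))}%R.
Proof.
move=> mW W2 mD opt.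
have iW := integrable_coord mW W2.
have vQ i := cond_exp_integrable_version mY (iW i).
pose Q w := vcond_exp P Y W w.
have mQ i : measurable_fun setT ((fun w => Q w i 0%R) : G -> R).
  have [mQi _ _] := vQ i; apply: eq_measurable_fun mQi => w _.
  by rewrite /Q mxE.
have mDY i : measurable_fun setT ((fun w => D (Y w) i 0%R) : G -> R).
  exact: measurable_preimage_comp (mD i).
pose g w := (inner (Q w) (D (Y w)) + 2^-1 * inner (D (Y w)) (D (Y w)))%R.
have mg : measurable_fun setT (g : G -> R).
  apply: measurable_funD.
    by apply: measurable_sum => i; exact: measurable_funM.
  apply: measurable_funM; first exact: measurable_cst.
  by apply: measurable_sum => i; exact: measurable_funM.
(* This sum dominates every coordinate of [D], so one truncation level bounds them all. *)
pose s w : R := (\sum_i `|D (Y w) i 0%R|)%R.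
have ms : measurable_fun setT (s : G -> R).
  by apply: measurable_sum => i; exact: measurableT_comp.
pose A (K : nat) : set Om := [set w | (g w < 0)%R] `&` [set w | (s w <= K%:R)%R].
have mA K : measurable (A K : set G).
  have mEg : measurable_fun setT (EFin \o g : G -> \bar R) by exact/measurable_EFinP.
  have mEs : measurable_fun setT (EFin \o s : G -> \bar R) by exact/measurable_EFinP.
  have := measurableI _ _ (measurable_lte measurableT mEg (measurable_cst 0))
    (measurable_lee measurableT mEs (measurable_cst K%:R%:E)).
  congr measurable; rewrite !setTI; apply/seteqP; split=> w /=; by rewrite lte_fin lee_fin.
have AK0 K : {ae P, forall w, \1_(A K) w * g w = 0}%R.
  have mAW : measurable (A K : set Om) := measurable_preimageW mY (mA K).
  pose a i w := (\1_(A K) w * D (Y w) i 0)%R.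
  have ma i : measurable_fun setT (a i : G -> R).
    by apply: measurable_funM => //; exact: (@measurable_indic _ G).
  have aM i : (exists M, forall w, `|a i w| <= M)%R.
    exists K%:R => w; rewrite /a indicE; case: (boolP (w \in A K)) => [|_].
      rewrite inE => -[_ /=]; apply: le_trans; rewrite mul1r.
      by rewrite /s (bigD1 i)//= lerDl sumr_ge0.
    by rewrite mul0r normr0.
  have maW i : measurable_fun (setT : set Om) (a i) :=
    measurable_fun_preimageW mY (ma i) measurableT.
  have va i := integrable_version_pull_out mY (iW i) (vQ i) (ma i) (aM i).
  have iaW i : P.-integrable setT (EFin \o (a i \* (fun w => W w i 0))%R).
    exact: integrable_bounded_mul.
  have iaQ i : P.-integrable setT (EFin \o (a i \* (fun w => Q w i 0))%R).
    by have [_ + _] := va i; apply: eq_integrable => // w _; rewrite /Q /= mxE.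
  have iaa i : P.-integrable setT (EFin \o (a i \* a i)%R).
    apply: integrable_bounded_mul => //.
    have -> : EFin \o a i = EFin \o (a i \* cst 1%R)%R.
      by apply/funext => w; rewrite /= mulr1.
    apply: integrable_bounded_mul => //.
    exact: finite_measure_integrable_cst.
  (* For [V = W], the sum over [i] is half the change of the squared error; for [V = Q] it is
     [1_(A K) g]. *)
  pose b (V : Om -> 'cV[R]_n) i w := (a i w * V w i 0 + 2^-1 * (a i w * a i w))%R.
  have ib (V : Om -> 'cV[R]_n) i :
      P.-integrable setT (EFin \o (a i \* (fun w => V w i 0))%R) ->
      P.-integrable setT (EFin \o b V i) /\
      \int[P]_w (b V i w)%:E =
        \int[P]_w (a i w * V w i 0)%:E + \int[P]_w (2^-1 * (a i w * a i w))%:E.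
    move=> iV; have i2 : P.-integrable setT (EFin \o (fun w => 2^-1 * (a i w * a i w))%R).
      exact: (integrableZl measurableT 2^-1 (iaa i)).
    split; first exact: (integrableD measurableT iV i2).
    exact: (integralD_EFin measurableT iV i2).
  have IbE (V : Om -> 'cV[R]_n) :
      (forall i, P.-integrable setT (EFin \o (a i \* (fun w => V w i 0))%R)) ->
      P.-integrable setT (EFin \o (fun w => \sum_i b V i w)%R) /\
      \int[P]_w (\sum_i b V i w)%:E = \sum_i \int[P]_w (b V i w)%:E.
    move=> iV; have S : EFin \o (fun w => \sum_i b V i w)%R =
        (fun w => \sum_i (EFin \o b V i) w) by apply/funext => w; rewrite /= sumEFin.
    have iS i : P.-integrable setT (EFin \o b V i) := (ib V i (iV i)).1.
    split; first by rewrite S; exact: integrable_sum.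
    rewrite -(integral_sum measurableT iS).
    by apply: eq_integral => w _; rewrite /= sumEFin.
  have [ibW ibWE] := IbE W iaW; have [ibQ ibQE] := IbE Q iaQ.
  (* Each [a i] is bounded and measurable for the sigma-algebra of [Y], so the pull-out property
     over the whole space replaces [W] by [Q]. *)
  have WQ : \int[P]_w (\sum_i b W i w)%:E = \int[P]_w (\sum_i b Q i w)%:E.
    rewrite ibWE ibQE; apply: eq_bigr => i _.
    rewrite (ib W i (iaW i)).2 (ib Q i (iaQ i)).2; congr (_ + _).
    have [_ _ /(_ setT (@measurableT _ G)) <-] := va i.
    by apply: eq_integral => w _; rewrite /Q /= mxE.
  have bQ w : (\sum_i b Q i w = \1_(A K) w * g w)%R.
    rewrite /b /a /g /inner mulrDr mulrCA !mulr_sumr -big_split/=.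
    apply: eq_bigr => i _; rewrite indicE; case: (_ \in _) => /=; ring.
  have bW w : inner (W w + \1_(A K) w *: D (Y w))%R (W w + \1_(A K) w *: D (Y w))%R =
      (inner (W w) (W w) + 2 * \sum_i b W i w)%R.
    rewrite /b /a /inner mulr_sumr -big_split/=.
    by apply: eq_bigr => i _; rewrite !mxE; field.
  have iWW : P.-integrable setT (EFin \o (fun w => inner (W w) (W w))).
    apply/integrableP; split.
      by apply/measurable_EFinP; apply: measurable_sum => j; exact: measurable_funM.
    by under eq_integral do rewrite /= ger0_norm ?inner_ge0//.
  have ib2 : P.-integrable setT (EFin \o (fun w => 2 * \sum_i b W i w)%R).
    exact: (integrableZl measurableT 2 ibW).
  have fE : (fun w => \1_(A K) w * g w)%R = (fun w => \sum_i b Q i w)%R.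
    by apply/funext => w; rewrite bQ.
  (* The function is nonpositive by the choice of [A K], while optimality makes its integral
     nonnegative. *)
  apply: nonpositive_integral_ae_eq0.
  - by rewrite fE.
  - move=> w; rewrite indicE; case: (boolP (w \in A K)) => [|_]; last by rewrite mul0r.
    by rewrite inE mul1r => -[/= /ltW].
  - have [B mB AB] := measurable_preimageE (mA K).
    have := opt _ mB.
    have -> : \int[P]_w (inner (W w + \1_B (Y w) *: D (Y w))%R
        (W w + \1_B (Y w) *: D (Y w))%R)%:E =
        \int[P]_w (inner (W w) (W w))%:E + \int[P]_w (2 * \sum_i b W i w)%:E.
      rewrite -(integralD_EFin measurableT iWW ib2); apply: eq_integral => w _.
      by rewrite -EFinD -bW AB; do 2?[congr EFin]; rewrite indicE /preimage.
    (* Cancelling the unperturbed cost is legitimate because it is finite. *)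
    rewrite -[leLHS]adde0 leeD2lE; last exact: (integrable_fin_num measurableT iWW).
    under eq_integral do rewrite EFinM.
    rewrite (integralZl measurableT ibW) WQ.
    rewrite pmule_rge0 ?lte_fin//.
    by under eq_integral do rewrite bQ.
have := ae_foralln AK0.
apply: filterS => w Aw; rewrite leNgt; apply/negP => gw.
(* A point with [g w < 0] lies in [A K] as soon as [K] exceeds [s w], and there the product would be
   [g w] itself. *)
have := Aw (Num.truncn (s w)).+1; rewrite indicE mem_set /=.
  by move/eqP; rewrite mul1r lt_eqF.
by split => //=; rewrite ltW// truncnS_gt.
Qed.

End variational.

(** * Tower property and pull-out with unbounded matrix factors *)

Section vector_pull_out.
Context {d d' d1} {Om : measurableType d} {T' : measurableType d'}
  {T1 : measurableType d1} {R : realType}.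
Variables (P : probability Om R) (Y : Om -> T') (Y1 : Om -> T1).
Hypotheses (mY : measurable_fun setT Y) (mY1 : measurable_fun setT Y1).
Local Notation G := (g_sigma_algebra_preimageType Y).
Local Notation G1 := (g_sigma_algebra_preimageType Y1).
Hypothesis GG1 : forall A : set Om, measurable (A : set G) -> measurable (A : set G1).
Local Open Scope ereal_scope.

Lemma integrable_version_sum n (W Z : 'I_n -> Om -> R) :
  (forall i, P.-integrable setT (EFin \o W i)) ->
  (forall i, integrable_version P Y (W i) (Z i)) ->
  integrable_version P Y (fun w => \sum_i W i w)%R (fun w => \sum_i Z i w)%R.
Proof.
move=> iW vZ.
have iZ i : P.-integrable setT (EFin \o Z i) by have [] := vZ i.
have S (V : 'I_n -> Om -> R) : EFin \o (fun w => \sum_i V i w)%R =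
    (fun w => \sum_i (EFin \o V i) w) by apply/funext => w; rewrite /= sumEFin.
split.
- by apply: measurable_sum => i; have [] := vZ i.
- by rewrite S; exact: integrable_sum.
- move=> A mA; have mAW : measurable (A : set Om) := measurable_preimageW mY mA.
  have SI (V : 'I_n -> Om -> R) : (forall i, P.-integrable setT (EFin \o V i)) ->
      \int[P]_(w in A) (\sum_i V i w)%:E = \sum_i \int[P]_(w in A) (V i w)%:E.
    move=> iV; rewrite -[RHS](integral_sum mAW (f := fun i => EFin \o V i)).
      by apply: eq_integral => w _; rewrite /= sumEFin.
    by move=> i; exact: integrableS (iV i).
  by rewrite !SI//; apply: eq_bigr => i _; have [_ _ ->] := vZ i.
Qed.

(** In the application [Y] is the state one step after [Y1]; the dynamics make it a Borel function
    of [Y1], so [Y] carries less information. *)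
Lemma integrable_version_tower (W Z Z1 : Om -> R) :
  integrable_version P Y W Z -> integrable_version P Y1 W Z1 ->
  integrable_version P Y Z1 Z.
Proof.
by move=> [mZ iZ ZW] [_ _ Z1W]; split => // A mA; rewrite ZW// Z1W//; exact: GG1.
Qed.

(* [M (Y w)] is unbounded, so the product need not be integrable; the weight
   [expR (- \sum_k `|M i k|)] reduces to a bounded factor. *)
Lemma cond_exp_pull_out_tower n (W : Om -> 'cV[R]_n) (M : T' -> 'M[R]_n) :
  (forall i, P.-integrable setT (EFin \o (fun w => W w i 0%R))) ->
  (forall i j, measurable_fun setT (fun y => M y i j)) ->
  {ae P, forall w,
    vcond_exp P Y (fun w => M (Y w) *m vcond_exp P Y1 W w)%R w =
    (M (Y w) *m vcond_exp P Y W w)%R}.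
Proof.
move=> iW mM.
pose Q w := vcond_exp P Y W w; pose Q1 w := vcond_exp P Y1 W w.
have vQ i : integrable_version P Y (fun w => W w i 0%R) (fun w => Q w i 0%R).
  have -> : (fun w => Q w i 0%R) = cond_exp P Y (fun w => W w i 0%R).
    by apply/funext => w; rewrite /Q mxE.
  exact: cond_exp_integrable_version.
have vQ1 i : integrable_version P Y1 (fun w => W w i 0%R) (fun w => Q1 w i 0%R).
  have -> : (fun w => Q1 w i 0%R) = cond_exp P Y1 (fun w => W w i 0%R).
    by apply/funext => w; rewrite /Q1 mxE.
  exact: cond_exp_integrable_version.
have iQ1 i : P.-integrable setT (EFin \o (fun w => Q1 w i 0%R)) by have [] := vQ1 i.
have mMY i j : measurable_fun setT ((fun w => M (Y w) i j) : G -> R).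
  exact: measurable_preimage_comp (mM i j).
suff H i : {ae P, forall w, cond_exp P Y (fun w => (M (Y w) *m Q1 w)%R i 0%R) w =
    (M (Y w) *m Q w)%R i 0%R}.
  have : {ae P, forall w, forall i, cond_exp P Y (fun w => (M (Y w) *m Q1 w)%R i 0%R) w =
    (M (Y w) *m Q w)%R i 0%R} by exact: filter_forall.
  apply: filterS => w Hw; apply/matrixP => i j; rewrite ord1 mxE Hw//.
pose s w : R := (\sum_k `|M (Y w) i k|)%R.
have ms : measurable_fun setT (s : G -> R).
  by apply: measurable_sum => k; exact: measurableT_comp.
have s0 w : (0 <= s w)%R by exact: sumr_ge0.
pose h w : R := expR (- s w).
have h0 w : (0 < h w)%R by exact: expR_gt0.
have mh : measurable_fun setT (h : G -> R).
  have mNs : measurable_fun setT ((fun w => - s w)%R : G -> R) by exact: measurableT_comp.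
  exact: (measurableT_comp (@measurable_expR R) mNs).
have mhV : measurable_fun setT ((fun w => (h w)^-1%R) : G -> R).
  have -> : (fun w => (h w)^-1)%R = expR \o s.
    by apply/funext => w; rewrite /h expRN invrK.
  exact: measurableT_comp.
pose a k w : R := (h w * M (Y w) i k)%R.
have ma k : measurable_fun setT (a k : G -> R) by exact: measurable_funM.
have aM k : exists B : R, forall w, (`|a k w| <= B)%R.
  (* The bound 1 comes from [|M i k| <= s <= 1 + s <= exp s]. *)
  exists 1%R => w; rewrite normrM gtr0_norm// /h expRN ler_pdivrMl ?expR_gt0// mulr1.
  apply: (@le_trans _ _ (s w)); first by rewrite /s (bigD1 k)//= lerDl sumr_ge0.
  by rewrite (le_trans _ (expR_ge1Dx _))// lerDr.
have va k := integrable_version_pull_out mY (iQ1 k)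
  (integrable_version_tower (vQ k) (vQ1 k)) (ma k) (aM k).
have iaQ1 k : P.-integrable setT (EFin \o (a k \* (fun w => Q1 w k 0))%R).
  apply: integrable_bounded_mul => //.
  exact: (measurable_fun_preimageW mY (ma k) (@measurableT _ G)).
have vS := integrable_version_sum iaQ1 va.
have hX (V : Om -> 'cV[R]_n) : (fun w => h w * (M (Y w) *m V w) i 0)%R =
    (fun w => \sum_k (a k w * V w k 0))%R.
  apply/funext => w; rewrite mxE mulr_sumr; apply: eq_bigr => k _.
  by rewrite mulrA.
have mX : measurable_fun (setT : set Om) (fun w => (M (Y w) *m Q1 w)%R i 0%R).
  under eq_fun do rewrite mxE.
  apply: measurable_sum => k; apply: measurable_funM.
    exact: (measurable_fun_preimageW mY (mMY i k) (@measurableT _ G)).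
  by apply/measurable_EFinP; exact: measurable_int (iQ1 k).
have iX : P.-integrable setT (EFin \o (h \* (fun w => (M (Y w) *m Q1 w) i 0))%R).
  have -> : (h \* (fun w => (M (Y w) *m Q1 w) i 0))%R =
      (fun w => \sum_k (a k w * Q1 w k 0))%R by rewrite -hX.
  have -> : EFin \o (fun w => \sum_k (a k w * Q1 w k 0))%R =
    (fun w => \sum_k (EFin \o (a k \* (fun w => Q1 w k 0))%R) w).
    by apply/funext => w; rewrite /= sumEFin.
  exact: integrable_sum.
have vS' : integrable_version P Y (h \* (fun w => (M (Y w) *m Q1 w) i 0))%R
    (fun w => \sum_k (a k w * Q w k 0))%R.
  rewrite (_ : (h \* _)%R = (fun w => \sum_k (a k w * Q1 w k 0))%R)//.
  by rewrite -hX.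
apply: filterS (cond_exp_ae mY (is_cond_exp_weighted mY mX mhV h0 iX vS')) => w ->.
have := congr1 (@^~ w) (hX Q); rewrite /= => <-.
by rewrite mulrC mulKf// gt_eqF.
Qed.

End vector_pull_out.

Lemma unif_continuous_continuous (U V : uniformType) (f : U -> V) :
  unif_continuous f -> continuous f.
Proof.
move=> cf x; apply/cvg_entourageP => E /cf entE; rewrite near_simpl.
have := nbhs_entourage x entE; apply: filterS => y /xsectionP.
by [].
Qed.

Lemma convex_set_segment (R : realType) m (U : set 'cV[R]_m) a b (e : R) :
  @convex_set R 'cV[R]_m U -> U a -> U b -> 0 <= e <= 1 ->
  U (a + e *: (b - a)).
Proof.
move=> cU Ua Ub /andP[e0 e1].
have := cU b a (Itv01 e0 e1) (mem_set Ub) (mem_set Ua); rewrite inE; congr U.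
by rewrite [LHS]/(e *: b + (1 - e) *: a) scalerBl scale1r scalerBr addrCA.
Qed.

Lemma continuous_addf (R : realType) (V : topologicalType) (f g : V -> R) :
  continuous f -> continuous g -> continuous (fun x => f x + g x).
Proof. by move=> cf cg x; exact: cvgD (cf x) (cg x). Qed.

Lemma continuous_mulf (R : realType) (V : topologicalType) (f g : V -> R) :
  continuous f -> continuous g -> continuous (fun x => f x * g x).
Proof. by move=> cf cg x; exact: cvgM (cf x) (cg x). Qed.

Lemma continuous_compf (U V W : topologicalType) (f : U -> V) (g : V -> W) :
  continuous f -> continuous g -> continuous (fun x => g (f x)).
Proof. by move=> cf cg x; exact: continuous_comp (cf x) (cg (f x)). Qed.

(** * Countable dense subsets and normal cones *)

Section countable_dense.
Context {R : realType} {m : nat}.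
Variable U : set 'cV[R]_m.

(** The rational points need not belong to [U]. For each rational centre and radius [1 / (j + 1)],
    choose a point of [U] within that distance whenever there is one, and [u0] otherwise. *)
Lemma countable_dense_subset : U !=set0 ->
  exists D : nat -> 'cV[R]_m, (forall k, U (D k)) /\
    forall v, U v -> forall e : R, 0 < e ->
    exists k, forall i, `|D k i 0 - v i 0| < e.
Proof.
move=> [u0 Uu0].
pose close (p : 'cV[rat]_m * nat) (u : 'cV[R]_m) :=
  forall i, `|u i 0 - ratr (p.1 i 0)| < p.2.+1%:R^-1.
have : forall p, exists u, U u /\ ((exists2 u', U u' & close p u') -> close p u).
  move=> p; have [[u Uu pu]|np] := pselect (exists2 u', U u' & close p u').
    by exists u.
  by exists u0; split.
move=> /choice[g gP].
exists (fun k => g (odflt (0, 0%N) (unpickle k))); split=> [k|v Uv e e0].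
  exact: (gP _).1.
have e20 : 0 < e / 2 by rewrite divr_gt0.
(* The radius [1 / (k + 1)] is below [e / 2]; both [v] and the chosen point lie within it of the
   same rational centre. *)
pose k := Num.truncn (e / 2)^-1.
have ke : k.+1%:R^-1 < e / 2.
  by rewrite invf_plt ?posrE// truncnS_gt.
have /choice[c cP] : forall i, exists q : rat, `|v i 0 - ratr q| < k.+1%:R^-1.
  move=> i; have : v i 0 - k.+1%:R^-1 < v i 0 + k.+1%:R^-1.
    by rewrite ltrD2l gt0_cp// invr_gt0.
  move=> /rat_in_itvoo[q]; rewrite in_itv/= => q12; exists q.
  by move: q12; rewrite ltr_norml; move: (ratr q) (_^-1) => r z /andP[? ?]; apply/andP; split; lra.
pose p : 'cV[rat]_m * nat := (\col_i c i, k).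
have pv : close p v by move=> i; rewrite /= mxE.
exists (pickle p) => i; rewrite pickleK /=.
have /(_ i) := (gP p).2 (ex_intro2 _ _ v Uv pv); have := pv i; rewrite /p /=.
move: (g _ i 0) (v i 0) ke => x y; move: (ratr _) (k.+1%:R^-1) => r z.
rewrite !ltr_norml => ? /andP[? ?] /andP[? ?].
by apply/andP; split; lra.
Qed.

(** If [<q, v - c>] were positive at some [v] in [U], it would remain positive at a point [D k]
    close enough to [v]. *)
Lemma normal_cone_dense (D : nat -> 'cV[R]_m) q c :
  (forall v, U v -> forall e : R, 0 < e ->
    exists k, forall i, `|D k i 0 - v i 0| < e) ->
  (forall k, inner q (D k - c) <= 0) -> normal_cone U c q.
Proof.
move=> dD qD v Uv; rewrite leNgt; apply/negP => qv.
pose s := \sum_i `|q i 0|.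
have s0 : 0 <= s by exact: sumr_ge0.
(* Replacing [v] by [D k] changes the inner product by at most [s] times this tolerance. Dividing by
   [s + 1] keeps that strictly below [<q, v - c>], also when [s = 0]. *)
have e0 : 0 < inner q (v - c) / (s + 1) by rewrite divr_gt0// ltr_wpDl.
have [k Dk] := dD v Uv _ e0.
have : inner q (v - c) = inner q (D k - c) - inner q (D k - v).
  by rewrite -innerNr -innerDr; congr inner; rewrite opprB addrACA addrC addrA subrK addrC.
have : `|inner q (D k - v)| <= s * (inner q (v - c) / (s + 1)).
  rewrite /inner (le_trans (ler_norm_sum _ _ _))// mulr_suml ler_sum// => i _.
  by rewrite normrM ler_wpM2l// !mxE ltW// -/(inner _ _) Dk.
rewrite ler_norml => /andP[a b] E.
have : s * (inner q (v - c) / (s + 1)) < inner q (v - c).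
  by rewrite mulrCA gtr_pMr// ltr_pdivrMr ?ltr_wpDl// mul1r ltrDl.
have := qD k; lra.
Qed.

End countable_dense.

(** * The closed-loop system and the costate *)

Section closed_loop.
Context {R : realType} {n m : nat}.
Variables (T : nat) (f : nat -> 'cV[R]_n * 'cV[R]_m -> 'cV[R]_n)
  (phi : nat -> 'cV[R]_n -> 'cV[R]_m).

Definition closed_loop t y := f t (y, phi t y).

(** The recursion peels off the earliest step, so that transposed Jacobians come out in increasing
    order of time, as in the costate. *)
Fixpoint flow t k y := if k is j.+1 then flow t.+1 j (closed_loop t y) else y.

(** The policy [psi] may differ from [phi] before time [t]; this serves policies modified at a
    single time. *)
Lemma state_flow (d : measure_display) (Om : measurableType d)
    (x0 : Om -> 'cV[R]_n) psi t k w :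
  (forall s, (t <= s)%N -> psi s = phi s) ->
  state f x0 psi (t + k) w = flow t k (state f x0 psi t w).
Proof.
elim: k t => [|k IH] t psiE; first by rewrite addn0.
rewrite -addSnnS IH => [|s ts]; last by rewrite psiE// ltnW.
by rewrite /= /closed_loop psiE.
Qed.

Hypothesis hf : forall t, (t < T)%N -> forall z, differentiable (f t) z.
Hypothesis hphi : forall t, (t < T)%N -> forall x, differentiable (phi t) x.
Hypothesis hfx : forall t, (t < T)%N -> forall i j,
  continuous (fun z => jac_x (f t) z i j).
Hypothesis hfu : forall t, (t < T)%N -> forall i j,
  continuous (fun z => jac_u (f t) z i j).
Hypothesis hphix : forall t, (t < T)%N -> forall i j,
  continuous (fun x => jac (phi t) x i j).

Lemma differentiable_closed_loop t y : (t < T)%N -> differentiable (closed_loop t) y.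
Proof. by move=> tT; exact: (jac_feedback (hphi tT y) (hf tT _)).1. Qed.

Lemma differentiable_flow t k y : (t + k <= T)%N -> differentiable (flow t k) y.
Proof.
elim: k t y => [|k IH] t y tT; first exact: ex_diff.
have tT' : (t < T)%N by rewrite (leq_trans _ tT)// -addSnnS leq_addr.
rewrite (_ : flow t k.+1 = flow t.+1 k \o closed_loop t)//.
apply: differentiable_comp; first exact: differentiable_closed_loop.
by apply: IH; rewrite addSnnS.
Qed.

Lemma continuous_flow t k : (t + k <= T)%N -> continuous (flow t k).
Proof. by move=> tT y; apply: differentiable_continuous; exact: differentiable_flow. Qed.

Lemma jac_flow0 t y : jac (flow t 0) y = 1%:M.
Proof.
apply: (@jac_eq _ _ _ (fun y : 'cV[R]_n => y)) => [|v]; first exact: ex_diff.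
by rewrite mul1mx diff_val.
Qed.

Lemma jac_flowS t k y : (t + k.+1 <= T)%N ->
  jac (flow t k.+1) y = jac (flow t.+1 k) (closed_loop t y) *m
    (jac_x (f t) (y, phi t y) + jac_u (f t) (y, phi t y) *m jac (phi t) y).
Proof.
move=> tT; have tT' : (t < T)%N by rewrite (leq_trans _ tT)// -addSnnS leq_addr.
rewrite -(jac_feedback (hphi tT' y) (hf tT' _)).2.
rewrite -(jac_comp (differentiable_closed_loop y tT') (differentiable_flow _ _))//.
by rewrite addSnnS.
Qed.

Lemma continuous_closed_loop_jac t i j : (t < T)%N ->
  continuous (fun y => (jac_x (f t) (y, phi t y) +
    jac_u (f t) (y, phi t y) *m jac (phi t) y) i j).
Proof.
move=> tT.
have cphi : continuous (fun y => (y, phi t y)).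
  move=> y; apply: differentiable_continuous; apply: differentiable_pair; last exact: hphi.
  exact: ex_diff.
under eq_fun do rewrite mxE [X in _ + X]mxE.
apply: continuous_addf.
  exact: (continuous_compf cphi (@hfx t tT i j)).
apply: sum_continuous => k; apply: continuous_mulf.
  exact: (continuous_compf cphi (@hfu t tT i k)).
exact: hphix.
Qed.

Lemma continuous_jac_flow t k i j : (t + k <= T)%N ->
  continuous (fun y => jac (flow t k) y i j).
Proof.
elim: k t i j => [|k IH] t i j tT.
  have -> : (fun y => jac (flow t 0) y i j) = cst ((1%:M : 'M[R]_n) i j).
    by apply/funext => y; rewrite jac_flow0.
  by move=> y; exact: cst_continuous.
have tT' : (t < T)%N by rewrite (leq_trans _ tT)// -addSnnS leq_addr.
under eq_fun do rewrite jac_flowS// mxE.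
apply: sum_continuous => l; apply: continuous_mulf.
  apply: (continuous_compf (f := closed_loop t) (g := fun y => jac (flow t.+1 k) y i l)).
    by move=> z; exact: differentiable_continuous (differentiable_closed_loop z tT').
  by apply: IH; rewrite addSnnS.
exact: continuous_closed_loop_jac.
Qed.

(** By the chain rule, the matrix product in the costate is the transposed Jacobian of the map from
    the state at time [t] to the terminal state. *)
Lemma prod_closed_loop_jac (d : measure_display) (Om : measurableType d)
    (x0 : Om -> 'cV[R]_n) t w : (t <= T)%N ->
  \prod_(t <= s < T) (closed_loop_jac f x0 phi s w)^T =
  (jac (flow t (T - t)) (state f x0 phi t w))^T.
Proof.
move=> tT; rewrite -{1}(subnKC tT); move: (T - t)%N (subnKC tT) => k tk.
have {tk}tT' : (t + k <= T)%N by rewrite tk.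
elim: k t tT tT' => [|k IH] t tT tkT.
  by rewrite addn0 big_geq// jac_flow0 trmx1.
rewrite big_ltn ?addnS ?ltnS ?leq_addr// -addSn IH.
- by rewrite jac_flowS// trmx_mul.
- by rewrite (leq_trans _ tkT)// -addSnnS leq_addr.
- by rewrite addSnnS.
Qed.

End closed_loop.

(** * Necessary conditions for an optimal policy *)

Section necessary_conditions.
Context {R : realType} {n m : nat} {d : measure_display}
  {Om : measurableType d}.
Variables (P : probability Om R) (T : nat) (U : set 'cV[R]_m)
  (f : nat -> 'cV[R]_n * 'cV[R]_m -> 'cV[R]_n)
  (x0 : Om -> 'cV[R]_n) (target : 'cV[R]_n -> 'cV[R]_n)
  (phi : nat -> 'cV[R]_n -> 'cV[R]_m).
Hypothesis mx0 : measurable_fun setT x0.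
Hypothesis mtarget : measurable_fun setT target.
Hypothesis U0 : U !=set0.
Hypothesis cU : @convex_set R 'cV[R]_m U.
Hypothesis hf : forall t, (t < T)%N -> forall z, differentiable (f t) z.
Hypothesis hphi : forall t, (t < T)%N -> forall x, differentiable (phi t) x.
Hypothesis hfx : forall t, (t < T)%N -> forall i j,
  continuous (fun z => jac_x (f t) z i j).
Hypothesis hfu : forall t, (t < T)%N -> forall i j,
  continuous (fun z => jac_u (f t) z i j).
Hypothesis hphix : forall t, (t < T)%N -> forall i j,
  continuous (fun x => jac (phi t) x i j).
Hypothesis opt : optimal P T U f x0 target phi.

Local Notation x := (state f x0 phi).
Local Notation W := (fun w => x T w - target (x0 w)).
Local Notation flow := (flow f phi).

Lemma measurable_state t : (t <= T)%N -> measurable_fun setT (x t).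
Proof.
move=> tT; have -> : x t = flow 0 t \o x0.
  by apply/funext => w; rewrite -[t in LHS]add0n (state_flow f x0 (phi := phi)).
apply: (measurableT_comp _ mx0); apply: measurable_continuous_cV_cV.
exact: (continuous_flow hf hphi).
Qed.

Lemma measurable_terminal_error i : measurable_fun setT (fun w => W w i 0).
Proof.
under eq_fun do rewrite !mxE.
apply: measurable_funB.
  exact: (measurableT_comp (measurable_coord_cV i) (measurable_state (leqnn T))).
exact: (measurableT_comp (measurable_coord_cV i) (measurableT_comp mtarget mx0)).
Qed.

Lemma objectiveE psi : objective P T f x0 target psi =
  (2^-1%:E * \int[P]_w (inner (state f x0 psi T w - target (x0 w))
    (state f x0 psi T w - target (x0 w)))%:E)%E.
Proof.
rewrite /objective unlock; congr (_ * _)%E.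
by apply: eq_integral => w _; rewrite enorm_sqr.
Qed.

(** Finite cost is part of optimality, and half of an infinite integral would still be infinite. *)
Lemma terminal_error_sqr_integrable :
  (\int[P]_w (inner (W w) (W w))%:E < +oo)%E.
Proof.
have [_ + _] := opt; rewrite objectiveE; set I := (\int[P]_w _)%E.
have : (0 <= I)%E by apply: integral_ge0 => w _; rewrite lee_fin inner_ge0.
case: I => [r| |] // _; first by move=> _; rewrite ltry.
by rewrite gt0_muley ?lte_fin ?invr_gt0 ?ltr0n// ltxx.
Qed.

Let iW := integrable_coord measurable_terminal_error terminal_error_sqr_integrable.

(** The terminal state reached from [y] when [u] is applied at time [t] and [phi] afterwards. *)
Definition response t y u := flow t.+1 (T - t.+1) (f t (y, u)).

Lemma state_response t w : (t < T)%N -> x T w = response t (x t w) (phi t (x t w)).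
Proof.
by move=> tT; rewrite -[in LHS](subnKC tT) (state_flow f x0 (phi := phi)).
Qed.

Lemma continuous_response t (u : 'cV[R]_n -> 'cV[R]_m) : (t < T)%N ->
  continuous u -> continuous (fun y => response t y (u y)).
Proof.
move=> tT cu; apply: (continuous_compf (f := fun y => f t (y, u y)) (g := flow t.+1 (T - t.+1))).
  apply: (continuous_compf (f := fun y => (y, u y)) (g := f t)).
    by move=> y; exact: (cvg_pair cvg_id (cu y)).
  by move=> z; exact: differentiable_continuous (hf tT z).
by apply: (continuous_flow hf hphi); rewrite subnKC.
Qed.

(** The competitor uses the convex combination [u] at time [t] for states in a Borel set [B].
    Convexity keeps it in [U], and since it only looks at the current state it is again a Markov
    policy; this is why the conditioning is on [x t]. *)
Lemma segment_variation t v k : (t < T)%N -> U v ->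
  {ae P, forall w, let D := response t (x t w)
      (phi t (x t w) + k.+1%:R^-1 *: (v - phi t (x t w))) -
      response t (x t w) (phi t (x t w)) in
    0 <= inner (vcond_exp P (x t) W w) D + 2^-1 * inner D D}.
Proof.
move=> tT Uv; have [pol _ le_opt] := opt.
have [mphi phiU] := pol _ tT.
pose u y := phi t y + k.+1%:R^-1 *: (v - phi t y).
have cphi : continuous (phi t).
  by move=> y; exact: differentiable_continuous (hphi tT y).
have cu : continuous u.
  move=> y; apply: (cvgD (cphi y)).
  exact: (cvgZ (cvg_cst (k.+1%:R^-1 : R)) (cvgB (cvg_cst v) (cphi y))).
have Uu y : U (u y).
  apply: convex_set_segment => //.
  by rewrite invr_ge0 ler0n/= invf_le1// ler1n.
pose D y := response t y (u y) - response t y (phi t y).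
apply: (minimizer_first_variation (D := D) (measurable_state (ltnW tT))
  measurable_terminal_error terminal_error_sqr_integrable).
  move=> i; under eq_fun do rewrite !mxE.
  by apply: measurable_funB; apply: (measurableT_comp (measurable_coord_cV i));
    apply: measurable_continuous_cV_cV; exact: continuous_response.
move=> B mB.
pose psi s y := if (s == t) && (y \in B) then u y else phi s y.
have psiE s : s != t -> psi s = phi s.
  by move=> st; apply/funext => y; rewrite /psi (negbTE st).
have pol_psi : markov_policy T U psi.
  move=> s sT; have [mphis phisU] := pol _ sT.
  have [->|st] := eqVneq s t; last by rewrite psiE.
  split; last by move=> y; rewrite /psi eqxx /=; case: ifP.
  rewrite /psi eqxx /=; apply: measurable_fun_ifT => //.
  - apply: (measurable_fun_bool true).
    rewrite [X in measurable X](_ : _ = B)//.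
    apply/seteqP; split=> z /= => [[_ /set_mem]//|Bz].
    by split=> //; exact: mem_set.
  - exact: measurable_continuous_cV_cV.
have psi_state s w : (s <= t)%N -> state f x0 psi s w = x s w.
  elim: s => [//|s IH] st /=.
  by rewrite IH ?(ltnW st)// psiE// ltn_eqF.
(* Both policies reach the same state at time [t] and coincide after it, so only the response to the
   control at time [t] differs. *)
have psi_T w : state f x0 psi T w - target (x0 w) =
    W w + \1_B (x t w) *: D (x t w).
  rewrite -[in LHS](subnKC tT) (state_flow f x0 (phi := phi)); last first.
    by move=> s ts; apply: psiE; rewrite gtn_eqF.
  rewrite /= psi_state// (state_response w tT) /D /psi eqxx indicE /=.
  case: (_ \in B); last by rewrite scale0r addr0.
  by rewrite scale1r /response [RHS]addrC addrA subrK.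
have := le_opt _ pol_psi; rewrite !objectiveE lee_pmul2l//.
by congr (_ <= _)%E; apply: eq_integral => w _; rewrite psi_T.
Qed.

Lemma costateE t w : (t <= T)%N -> costate P T f x0 target phi t w =
  (jac (flow t (T - t)) (x t w))^T *m vcond_exp P (x t.-1) W w.
Proof. by move=> tT; rewrite /costate (prod_closed_loop_jac hf hphi). Qed.

(** One null set serves all step sizes and all points of the countable dense set. Outside it, the
    first-order condition for the response as a function of the control applies pointwise; the
    costate at [t.+1] conditions on [x t], as the variation does. *)
Lemma jac_u_costate t : (t < T)%N -> {ae P, forall w,
  normal_cone U (phi t (x t w)) (- ((jac_u (f t) (state_control f x0 phi t w))^T *m
    costate P T f x0 target phi t.+1 w))}.
Proof.
move=> tT; have [D [UD dD]] := countable_dense_subset U0.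
have := ae_foralln (fun j => ae_foralln (fun k => segment_variation k tT (UD j))).
apply: filterS => w Hw; apply: normal_cone_dense dD _ => j.
rewrite innerNl oppr_le0 inner_mulmx costateE// inner_mulmx.
set y := x t w; set u0 := phi t y.
have dfu : differentiable (fun u => f t (y, u)) u0 := (diff_partial_u (hf tT (y, u0))).1.
have dfl : differentiable (flow t.+1 (T - t.+1)) (f t (y, u0)).
  by apply: (differentiable_flow hf hphi); rewrite subnKC.
rewrite mulmxA -[_ *m jac_u _ _](jac_comp dfu dfl).
apply: first_order_condition; first exact: differentiable_comp.
by move=> k; exact: Hw.
Qed.

(** Pulling out the flow Jacobian at [x t] and applying the tower property gives that transposed
    Jacobian times [E[W | x t]]. Splitting off its first step yields the closed-loop Jacobian acting
    on the next costate, and the feedback term vanishes by normality. *)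
Lemma costate_cond_exp t : (0 < t < T)%N -> {ae P, forall w,
  vcond_exp P (x t) (costate P T f x0 target phi t) w =
  (jac_x (f t) (state_control f x0 phi t w))^T *m costate P T f x0 target phi t.+1 w}.
Proof.
(* From here on the time of the statement is [t.+1], and its costate conditions on [x t]. *)
case: t => // t /andP[_ tT]; have tT' := ltnW tT.
have mM i j : measurable_fun setT
    (fun y => (jac (flow t.+1 (T - t.+1)) y)^T i j : R).
  under eq_fun do rewrite mxE.
  apply: measurable_continuous_cV.
  by apply: (continuous_jac_flow hf hphi hfx hfu hphix); rewrite subnKC.
have sub (A : set Om) : measurable (A : set (g_sigma_algebra_preimageType (x t.+1))) ->
    measurable (A : set (g_sigma_algebra_preimageType (x t))).
  move=> /measurable_preimageE[B mB ->].
  exists (closed_loop f phi t @^-1` B); last by rewrite setTI.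
  rewrite -[X in measurable X]setTI.
  apply: (@measurable_continuous_cV_cV _ _ _ (closed_loop f phi t)) => //.
  by move=> y; apply: differentiable_continuous; exact: (differentiable_closed_loop hf hphi).
have := cond_exp_pull_out_tower (measurable_state (ltnW tT))
  (measurable_state (ltnW tT')) sub iW mM.
apply: filterS2 (jac_u_costate tT) => w Nw.
rewrite (_ : (fun w => _ *m _) = costate P T f x0 target phi t.+1); last first.
  by apply/funext => w'; rewrite costateE.
move=> ->.
have [_ phiU] : measurable_fun setT (phi t.+1) /\ forall y, U (phi t.+1 y).
  by have [+ _ _] := opt; exact.
have := normal_cone_tangent (hphi tT _) phiU Nw.
rewrite mulmxN => /eqP; rewrite oppr_eq0 => /eqP tang.
rewrite [in RHS]costateE// -[in LHS](subnSK tT).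
rewrite (jac_flowS hf hphi); last by rewrite subnSK// subnKC// ltnW.
rewrite trmx_mul -mulmxA -[X in _ *m X](costateE w tT).
by rewrite linearD /= trmx_mul mulmxDl -[X in _ + X]mulmxA tang addr0 costateE.
Qed.

(** The product is empty at time [T], and the terminal state is a Borel function of the preceding
    state, hence its own conditional expectation. *)
Lemma costate_terminal : (0 < T)%N ->
  (\int[P]_w (inner (target (x0 w)) (target (x0 w)))%:E < +oo)%E ->
  {ae P, forall w, costate P T f x0 target phi T w =
    x T w - vcond_exp P (x T.-1) (fun w' => target (x0 w')) w}.
Proof.
move=> T0 t2.
have mY := measurable_state (leq_pred T).
have itgt := integrable_coord (W := target \o x0) 
  (fun i => measurableT_comp (measurable_coord_cV i) (measurableT_comp mtarget mx0)) t2.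
have H i : {ae P, forall w, cond_exp P (x T.-1) (fun w' => W w' i 0) w =
    x T w i 0 - cond_exp P (x T.-1) (fun w' => target (x0 w') i 0) w}.
  (* Integrability of the terminal state follows by adding the target back to the error. *)
  have ixT : P.-integrable setT (EFin \o (fun w => x T w i 0)).
    have := integrableD measurableT (iW i) (itgt i).
    by apply: eq_integrable => // w _; rewrite /= !mxE -EFinD subrK.
  have vxT : integrable_version P (x T.-1) (fun w => x T w i 0) (fun w => x T w i 0).
    split => //.
    have -> : (fun w => x T w i 0) = (fun y => closed_loop f phi T.-1 y i 0) \o x T.-1.
      by apply/funext => w; rewrite -[in LHS](prednK T0).
    apply: measurable_preimage_comp.
    apply: (measurableT_comp (measurable_coord_cV i)); apply: measurable_continuous_cV_cV => y.
    apply: differentiable_continuous; apply: (differentiable_closed_loop hf hphi).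
    by rewrite prednK.
  have := integrable_versionB mY ixT (itgt i) vxT (cond_exp_integrable_version mY (itgt i)).
  have -> : ((fun w => x T w i 0) \- (fun w => (target \o x0) w i 0)) = (fun w => W w i 0).
    by apply/funext => w; rewrite /= !mxE.
  exact: (integrable_version_unique mY (cond_exp_integrable_version mY (iW i))).
have : {ae P, forall w, forall i, cond_exp P (x T.-1) (fun w' => W w' i 0) w =
    x T w i 0 - cond_exp P (x T.-1) (fun w' => target (x0 w') i 0) w}.
  exact: filter_forall.
apply: filterS => w Hw; rewrite /costate big_geq// mul1mx.
by apply/matrixP => i j; rewrite ord1 !mxE Hw.
Qed.

End necessary_conditions.

Unset Implicit Arguments.
Set Strict Implicit.
Set Printing Implicit Defensive.

Theorem theorem2p2 (R : realType) (n m : nat)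
    (d : measure_display) (Omega : measurableType d) (P : probability Omega R)
    (T : nat) (hT : (1 <= T)%N)
    (U : set 'cV[R]_m) (hU0 : U !=set0) (hU : measurable U)
    (f : nat -> 'cV[R]_n * 'cV[R]_m -> 'cV[R]_n)
    (mu : probability 'cV[R]_n R) (hmu : finite_second_moment mu)
    (x0 : {RV P >-> 'cV[R]_n})
    (hx0 : forall A, measurable A -> distribution P x0 A = mu A)
    (target : 'cV[R]_n -> 'cV[R]_n) (htarget : L2 mu target)
    (hUconvex : @convex_set R 'cV[R]_m U)
    (hfdiff : forall t, (t < T)%N -> forall z, differentiable (f t) z)
    (hfx : forall t, (t < T)%N -> forall i j,
      unif_continuous (fun z => jac_x (f t) z i j))
    (hfu : forall t, (t < T)%N -> forall i j,
      unif_continuous (fun z => jac_u (f t) z i j))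
    (hfgrowth : forall t, (t < T)%N -> exists2 mt : R, 0 < mt &
      forall x u, enorm (f t (x, u)) <= mt * (1 + enorm x + enorm u))
    (phi : nat -> 'cV[R]_n -> 'cV[R]_m)
    (hphi : markov_policy T U phi)
    (hphidiff : forall t, (t < T)%N -> forall x, differentiable (phi t) x)
    (hphijac : forall t, (t < T)%N -> forall i j,
      unif_continuous (fun x => jac (phi t) x i j))
    (hopt : optimal P T U f x0 target phi) :
  let x := state f x0 phi in
  let xu := state_control f x0 phi in
  let p := costate P T f x0 target phi in
  [/\ {ae P, forall w,
        p T w = x T w - vcond_exp P (x T.-1) (fun w' => target (x0 w')) w},
      forall t, (1 <= t < T)%N -> {ae P, forall w,
        vcond_exp P (x t) (p t) w = (jac_x (f t) (xu t w))^T *m p t.+1 w} &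
      forall t, (t < T)%N -> {ae P, forall w,
        [set a + b | a in [set (jac_u (f t) (xu t w))^T *m p t.+1 w]
                   & b in normal_cone U (phi t (x t w))] 0}].
Proof.
have mx0 : measurable_fun setT x0 by exact: measurable_funPT.
have [mtarget target2] := htarget.
have cfx t : (t < T)%N -> forall i j, continuous (fun z => jac_x (f t) z i j).
  by move=> tT i j; exact: unif_continuous_continuous (hfx t tT i j).
have cfu t : (t < T)%N -> forall i j, continuous (fun z => jac_u (f t) z i j).
  by move=> tT i j; exact: unif_continuous_continuous (hfu t tT i j).
have cphi t : (t < T)%N -> forall i j, continuous (fun y => jac (phi t) y i j).
  by move=> tT i j; exact: unif_continuous_continuous (hphijac t tT i j).
split.
- apply: (costate_terminal mx0 mtarget hfdiff hphidiff hopt) => //.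
  apply: le_lt_trans target2.
  (* Square integrability of the target under [mu] is transported to [Omega] through the law of
     [x0]. *)
  rewrite -(@eq_measure_integral _ _ _ setT mu (distribution P x0)); last first.
    by move=> A mA _; exact: hx0.
  rewrite ge0_integral_pushforward//; last 2 first.
  + apply/measurable_EFinP; under eq_fun do rewrite enorm_sqr.
    by apply: measurable_sum => i; apply: measurable_funM;
      exact: (measurableT_comp (measurable_coord_cV i) mtarget).
  + by move=> y _; rewrite lee_fin sqr_ge0.
  rewrite preimage_setT le_eqVlt; apply/orP; left; apply/eqP.
  by apply: eq_integral => w _; rewrite /= enorm_sqr.
- move=> t tT.
  exact: (costate_cond_exp mx0 mtarget hU0 hUconvex hfdiff hphidiff cfx cfu cphi hopt).
- move=> t tT.
  have := jac_u_costate mx0 mtarget hU0 hUconvex hfdiff hphidiff hopt tT.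
  apply: filterS => w Nw.
  (* Zero is the sum of the gradient term and its negative, which is the normal vector just
     obtained. *)
  by exists ((jac_u (f t) (state_control f x0 phi t w))^T *m costate P T f x0 target phi t.+1 w) => //;
    eexists; [exact: Nw|rewrite subrr].
Qed.
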